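(* Let $b\in\ell^1$ be a non-trivial modulus support functional for the set $S_0\subset c_0$. Then there is a measure $\mu\in\mathcal{R}$ such that the sequence $(\widehat\mu(-n))_{n\ge 0}$ of its Fourier--Stieltjes coefficients belongs to $S_0$ and is a modulus support point of $S_0$ corresponding to $b$. Moreover, the set $E=\operatorname{supp}\mu$ is a weak peak set for $W^+$, with $f_b$ being a corresponding weak peak function.
   Context: All spaces are complex. $\mathbb{D}=\{z\in\mathbb{C}:|z|<1\}$, $\mathbb{T}=\{z\in\mathbb{C}:|z|=1\}$, $\overline{\mathbb{D}}=\mathbb{D}\cup\mathbb{T}$. Duality: $c_0=c_0(\mathbb{Z}_+)$ with the sup norm, and $c_0^*$ is identified with $\ell^1=\ell^1(\mathbb{Z}_+)$ via the bilinear coupling $\langle a,x\rangle=\sum_{n\ge0}x_na_n$, $x\in c_0$, $a\in\ell^1$. Wiener algebra: $W^+$ is the algebra of functions $f_a(z)=\sum_{n\ge0}a_nz^n$ with $a=(a_n)_{n\ge0}\in\ell^1$ (analytic in $\mathbb{D}$, continuous on $\overline{\mathbb{D}}$). $\|f\|_\infty=\sup_{z\in\overline{\mathbb{D}}}|f(z)|$. A functional $a\in\ell^1$ is called non-trivial if it is not of the form $(\alpha,0,0,\ldots)$ with $\alpha\in\mathbb{C}$, i.e. $f_a$ is non-constant. The set $S_0$: for $\lambda\in\mathbb{D}$ let $\varphi_\lambda=(\lambda^j)_{j\ge0}\in c_0$ (with $0^0=1$). $S_0$ is the closed convex hull in $c_0$ of $\{\varphi_\lambda:\lambda\in\mathbb{D}\}$.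 Modulus support functionals: for a non-empty bounded closed convex subset $C$ of a Banach space $X$, a non-zero functional $h\in X^*$ is a modulus support functional for $C$ if there is $y\in C$ with $|h(y)|=\sup_{x\in C}|h(x)|$; such a point $y$ is called a modulus support point of $C$ corresponding to $h$. Class $\mathcal{R}$: for a finite complex Borel measure $\mu$ on $\mathbb{T}$, $\widehat\mu(k)=\int_{\mathbb{T}}t^{-k}\,\mu(dt)$, $k\in\mathbb{Z}$. The measure $\mu$ belongs to $\mathcal{R}$ (Rajchman class) if $\lim_{n\to+\infty}\widehat\mu(-n)=0$. Weak peak sets: a closed set $E\subset\mathbb{T}$ of Lebesgue measure zero is a weak peak set for $W^+$ if there are a function $g_E\in W^+$ (called a weak peak function for $E$) and a complex number $\beta\ne0$ such that $g_E=\beta$ on $E$ and $\|g_E\|_\infty=|\beta|$. *)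

(* Defs.v *)
From HB Require Import structures.
From mathcomp Require Import all_boot all_order all_algebra.
From mathcomp Require Import complex.
From mathcomp Require Import all_classical all_reals all_analysis.

Set Implicit Arguments.
Unset Strict Implicit.
Unset Printing Implicit Defensive.

Import Order.TTheory GRing.Theory Num.Theory.
Import numFieldNormedType.Exports.
Import Normc.

Local Open Scope classical_set_scope.
Local Open Scope ring_scope.
Local Open Scope complex_scope.

(* [R[i]] gets the topology and the norm of the numeric field [R[i]^o]. *)
HB.instance Definition _ (R : realType) := NormedModule.copy R[i] R[i]^o.

Section SequenceSpaces.
Variable R : realType.
Implicit Types (a x y : nat -> R[i]) (lambda : R[i]).

Definition c0 : set (nat -> R[i]) := [set x | x @ \oo --> (0 : R[i])].

Definition ell1 : set (nat -> R[i]) :=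
  [set a | summable [set: nat] (fun n => (normc (a n))%:E)].

Definition coupling a x : R[i] := limn (series (fun n => x n * a n)).

Definition phi lambda : nat -> R[i] := fun j => lambda ^+ j.

(* The closure is taken in the uniform topology, which induces the sup-norm
   topology on [c0]. The weights in [convex_set] are scalars [t : R[i]] with
   [0 <= t <= 1]; in the order of [R[i]] such scalars are real. *)
Definition S0 : set (nat -> R[i]) :=
  c0 `&` closure (smallest (@convex_set R[i] (nat -> R[i]))
                    [set phi lambda | lambda in [set l | normc l < 1]]
                  : set {uniform nat -> R[i]}).

Definition modulus_support_point (A : set (nat -> R[i])) a y :=
  A y /\
  (normc (coupling a y))%:E =
    ereal_sup [set (normc (coupling a x))%:E | x in A].

Definition modulus_support_functional (A : set (nat -> R[i])) a :=
  [/\ ell1 a, a <> (fun=> 0) & exists y, modulus_support_point A a y].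

Definition nontrivial a :=
  ~ exists alpha : R[i], a = (fun n => if n == 0%N then alpha else 0).

End SequenceSpaces.

Section WienerAlgebra.
Variable R : realType.
Implicit Types (a : nat -> R[i]) (f g : R[i] -> R[i]).

Definition closed_disc : set R[i] := [set z | normc z <= 1].

Definition power_sum a (z : R[i]) : R[i] :=
  limn (series (fun n => a n * z ^+ n)).

(* An element of W^+ is a function on the closed disc: the values of [f]
   elsewhere are irrelevant. *)
Definition wiener_plus f :=
  exists2 a, ell1 a & forall z, closed_disc z -> f z = power_sum a z.

Definition sup_norm f : \bar R := ereal_sup [set (normc (f z))%:E | z in closed_disc].

End WienerAlgebra.

Section Circle.
Variable R : realType.

Definition unit_circle : set R[i] := [set z | normc z = 1].

Definition circle := set_type unit_circle.

HB.instance Definition _ := Topological.on circle.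

Lemma unit_circle1 : (1 : R[i]) \in unit_circle.
Proof. by apply/mem_set; exact: normc1. Qed.

HB.instance Definition _ :=
  isPointed.Build circle (exist _ (1 : R[i]) unit_circle1).

Definition borel_circle := g_sigma_algebraType (@open circle).

Definition arc_length (E : set circle) : \bar R :=
  lebesgue_measure
    [set theta : R | 0 <= theta < 2 * pi
                     /\ [set set_val t | t in E] (cos theta +i* sin theta)].

End Circle.

Section ComplexMeasures.
Variable R : realType.

Section ChargeIntegral.
Variables (d : measure_display) (T : measurableType d).
Variable nu : {charge set T -> \bar R}.

Definition charge_pos : {measure set T -> \bar R} :=
  jordan_pos (svalP (cid (svalP (cid (Hahn_decomposition nu))))).

Definition charge_neg : {measure set T -> \bar R} :=
  jordan_neg (svalP (cid (svalP (cid (Hahn_decomposition nu))))).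

Definition charge_integral (f : T -> R) : R :=
  Rintegral charge_pos setT f - Rintegral charge_neg setT f.

End ChargeIntegral.

(* A finite complex Borel measure on the circle, given by its real and
   imaginary parts; charges are finite-valued. *)
Record complex_measure := ComplexMeasure {
  re_charge : {charge set (borel_circle R) -> \bar R} ;
  im_charge : {charge set (borel_circle R) -> \bar R} }.

Implicit Types mu : complex_measure.

Definition cmeasure_val mu (A : set (borel_circle R)) : R[i] :=
  fine (re_charge mu A) +i* fine (im_charge mu A).

Definition cintegral mu (f : borel_circle R -> R[i]) : R[i] :=
  let u t := complex.Re (f t) in
  let v t := complex.Im (f t) in
  (charge_integral (re_charge mu) u - charge_integral (im_charge mu) v)
  +i* (charge_integral (re_charge mu) v + charge_integral (im_charge mu) u).

Definition fourier mu (k : int) : R[i] :=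
  cintegral mu (fun t => set_val (t : circle R) ^ (- k)).

Definition rajchman mu :=
  (fun n : nat => fourier mu (- n%:Z)) @ \oo --> (0 : R[i]).

(* A point is in the support when no open neighbourhood of it is null for the
   total variation of [mu], i.e. each one has a Borel subset of non-zero
   measure. *)
Definition measure_support mu : set (circle R) :=
  [set t | forall U : set (circle R), open_nbhs t U ->
     exists A : set (borel_circle R),
       [/\ measurable A, A `<=` U & cmeasure_val mu A <> 0]].

End ComplexMeasures.

Section WeakPeakSets.
Variable R : realType.

Definition weak_peak_function (E : set (circle R)) (g : R[i] -> R[i]) :=
  wiener_plus g /\
  exists beta : R[i],
    [/\ beta <> 0, forall t, E t -> g (set_val t) = beta
      & sup_norm g = (normc beta)%:E].

Definition weak_peak_set (E : set (circle R)) :=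
  [/\ closed E, arc_length E = 0%E & exists g, weak_peak_function E g].

End WeakPeakSets.

(* Main.v *)
Require Import Defs.
From HB Require Import structures.
From mathcomp Require Import all_boot all_order all_algebra.
From mathcomp Require Import complex.
From mathcomp Require Import all_classical all_reals all_analysis.
From mathcomp Require Import ring lra zify.

(** Write [f] for the power sum of [b], [beta] for the pairing of [b] with the
    given support point [y], and [M] for the modulus of [beta]; [M] bounds
    [|f|] on the closed disc because [f l] is the pairing of [b] with the
    geometric sequence of ratio [l].

    Every point of the closed convex hull is the sequence of moments of a
    probability measure on the circle ([representing_measure]).  A geometric
    sequence of ratio [l] in the open disc is the moment sequence of the
    Poisson kernel of [l], and that kernel may be sampled at the [N]-th roots
    of unity up to an error that tends to 0 with [N] ([poisson_momentE]).
    Approximability by moments of positive weights on roots of unity is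
    preserved by convex combinations and by uniform limits, so it holds on the
    whole hull ([S0_approximable]).  The distribution functions of these
    weights converge along an ultrafilter to a monotone function [F] whose
    Riemann sums approximate [y] ([helly_selection]), and the image of the
    uniform law on the unit interval under the generalized inverse of [F],
    followed by [cis], is the measure [nu] that is sought.

    So [y] itself is the sequence of Fourier-Stieltjes coefficients of [nu]; it
    belongs to the hull and tends to 0 by assumption.  It remains to locate the
    support of [nu].  The function [M^2 - Re (conj beta * f)] is continuous and
    non-negative on the circle, and its integral against [nu] is
    [M^2 - Re (conj beta * beta) = 0].  Hence it vanishes on the support, which
    forces [f = beta] there ([support_level_set]), and it cannot be bounded
    below by a positive number, which forces the supremum of [|f|] to be [M]
    ([sup_norm_power_sum]).

    Finally a level set of a non-constant [f] on the circle is null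
    ([null_level_set]).  After subtraction of the level and division by a power
    of [z], this is the uniqueness theorem for zeros on the circle of a power
    series [f] with [f 0 != 0].  A discrete form of Jensen's inequality says
    that the geometric mean of the modulus of a polynomial [p] over equally
    spaced points of a circle about 0 is essentially at least [|p 0|]
    ([near_geometric_mean]).  If the zeros of [f] met a fixed proportion of the
    arcs between consecutive roots of unity, then a partial sum of [f] would be
    arbitrarily small at the same proportion of the roots of unity, against
    this inequality ([few_zero_cells]). *)

Set Implicit Arguments.
Unset Strict Implicit.
Unset Printing Implicit Defensive.

Import Order.TTheory GRing.Theory Num.Theory.
Import numFieldNormedType.Exports.
Import Normc.
Local Open Scope classical_set_scope.
Local Open Scope ring_scope.
Local Open Scope complex_scope.

(** * Complex numbers through their real and imaginary parts *)

Section ComplexBasics.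
Variable R : realType.
Implicit Types (z w : R[i]) (x e : R).

Lemma normr_normc z : `|z| = (normc z)%:C.
Proof. by []. Qed.

Lemma normc_ge0 z : 0 <= normc z.
Proof. by case: z => a b; exact: sqrtr_ge0. Qed.

Lemma normc_eq0 z : (normc z == 0) = (z == 0).
Proof. by apply/eqP/eqP => [/eq0_normc|->]; last exact: normc0. Qed.

Lemma normcX z n : normc (z ^+ n) = normc z ^+ n.
Proof. by elim: n => [|n IH]; rewrite ?expr0 ?normc1// !exprS normcM IH. Qed.

Lemma normc_real x : normc (x%:C) = `|x|.
Proof. by rewrite /= expr0n/= addr0 sqrtr_sqr. Qed.

Lemma normcB z w : normc (z - w) = normc (w - z).
Proof. by rewrite -normcN opprB. Qed.

Lemma normc_conj z : normc (conjc z) = normc z.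
Proof. by case: z => a b /=; rewrite sqrrN. Qed.

Lemma le_normcB z w : normc z - normc w <= normc (z - w).
Proof. by rewrite lerBlDr -{1}(subrK w z) le_normcD. Qed.

Lemma le_normc_sum (I : Type) (r : seq I) (P : pred I) (F : I -> R[i]) :
  normc (\sum_(i <- r | P i) F i) <= \sum_(i <- r | P i) normc (F i).
Proof.
elim/big_rec2: _ => [|i a b _ h]; first by rewrite normc0.
by rewrite (le_trans (le_normcD _ _))// lerD2l.
Qed.

Lemma normc_prod (I : Type) (r : seq I) (P : pred I) (F : I -> R[i]) :
  normc (\prod_(i <- r | P i) F i) = \prod_(i <- r | P i) normc (F i).
Proof. by apply: (big_morph _ (@normcM R) (@normc1 R)). Qed.

Lemma le_Re_normc z : `|complex.Re z| <= normc z.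
Proof.
by case: z => a b /=; rewrite -sqrtr_sqr ler_wsqrtr// lerDl sqr_ge0.
Qed.

Lemma le_Im_normc z : `|complex.Im z| <= normc z.
Proof.
by case: z => a b /=; rewrite -sqrtr_sqr ler_wsqrtr// lerDr sqr_ge0.
Qed.

Lemma le_normc_ReIm z : normc z <= `|complex.Re z| + `|complex.Im z|.
Proof.
case: z => a b /=; rewrite -[leRHS]ger0_norm ?addr_ge0// -sqrtr_sqr ler_wsqrtr//.
rewrite sqrrD !real_normK ?num_real// addrAC lerDl.
by rewrite mulrn_wge0 ?mulr_ge0.
Qed.

Lemma sqr_normcE z : normc z ^+ 2 = complex.Re z ^+ 2 + complex.Im z ^+ 2.
Proof. by case: z => a b /=; rewrite sqr_sqrtr// addr_ge0 ?sqr_ge0. Qed.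

Lemma ReD z w : complex.Re (z + w) = complex.Re z + complex.Re w.
Proof. by case: z; case: w. Qed.

Lemma ImD z w : complex.Im (z + w) = complex.Im z + complex.Im w.
Proof. by case: z; case: w. Qed.

Lemma ReN z : complex.Re (- z) = - complex.Re z.
Proof. by case: z. Qed.

Lemma ImN z : complex.Im (- z) = - complex.Im z.
Proof. by case: z. Qed.

Lemma Re_sum (I : Type) (r : seq I) (P : pred I) (F : I -> R[i]) :
  complex.Re (\sum_(i <- r | P i) F i) = \sum_(i <- r | P i) complex.Re (F i).
Proof. exact: (big_morph _ ReD). Qed.

Lemma Im_sum (I : Type) (r : seq I) (P : pred I) (F : I -> R[i]) :
  complex.Im (\sum_(i <- r | P i) F i) = \sum_(i <- r | P i) complex.Im (F i).
Proof. exact: (big_morph _ ImD). Qed.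

(** The modulus of a complex number is here a complex number; this puts
    convergence in terms of the real-valued modulus. *)
Lemma cvg_normcP (T : Type) (F : set_system T) (FF : Filter F)
    (u : T -> R[i]) (l : R[i]) :
  u @ F --> l <->
  forall e, 0 < e -> \forall t \near F, normc (l - u t) < e.
Proof.
split=> [/cvgrPdist_lt ul e e0|ul].
  have /ul : 0 < e%:C by rewrite ltcR.
  by apply: filterS => t; rewrite normr_normc ltcR.
apply/cvgrPdist_lt => -[a b]; rewrite ltcE/= => /andP[/eqP-> a0].
by apply: filterS (ul a a0) => t; rewrite normr_normc ltcR.
Qed.

Lemma cvg_ReIm (T : Type) (F : set_system T) (FF : Filter F)
    (u v : T -> R) (a b : R) :
  u @ F --> a -> v @ F --> b -> (fun t => u t +i* v t) @ F --> a +i* b.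
Proof.
move=> /cvgrPdist_lt ua /cvgrPdist_lt vb; apply/cvg_normcP => e e0.
have e20 : 0 < e / 2 by rewrite divr_gt0.
near=> t.
have h1 : `|a - u t| < e / 2 by near: t; exact: ua.
have h2 : `|b - v t| < e / 2 by near: t; exact: vb.
apply: (le_lt_trans (le_normc_ReIm _)) => /=.
by rewrite (splitr e) ltrD.
Unshelve. all: by end_near.
Qed.

Lemma series_le_limn (u : nat -> R) n : (forall k, 0 <= u k) -> cvgn (series u) ->
  series u n <= limn (series u).
Proof.
move=> u0 cu; apply: nondecreasing_cvgn_le => //.
by apply: nondecreasing_series => k _ _; exact: u0.
Qed.

End ComplexBasics.

(** * Power series with absolutely summable coefficients *)

Section PowerSums.
Variable R : realType.
Implicit Types (a c : nat -> R[i]) (z w : R[i]).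

(** The remainder of the [l^1] norm bounds, uniformly, the remainders of both the
    pairing with a sequence of the unit ball and the power sum on the closed
    disc. *)
Definition l1_tail a N : R :=
  limn (series (fun n => normc (a n))) - series (fun n => normc (a n)) N.

Lemma ell1_cvg a : ell1 a -> cvgn (series (fun n => normc (a n))).
Proof.
rewrite /ell1 /= => sa.
have -> : series (fun n => normc (a n)) =
   (fun n => \sum_(0 <= i < n | predT i) fine (normc (a i))%:E)%R by [].
apply: summable_cvg => [i _|]; first by rewrite lee_fin normc_ge0.
by rewrite [X in summable X _](_ : _ = setT)//; apply/seteqP.
Qed.

Lemma l1_tail_ge0 a N : ell1 a -> 0 <= l1_tail a N.
Proof.
by move=> /ell1_cvg ca; rewrite subr_ge0 series_le_limn// => k; exact: normc_ge0.
Qed.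

Lemma l1_tail_cvg a : ell1 a -> l1_tail a @ \oo --> (0 : R).
Proof.
move=> /ell1_cvg ca; rewrite -(subrr (limn (series (fun n => normc (a n))))).
by apply: cvgB => //; exact: cvg_cst.
Qed.

Lemma real_series_dominated (c : nat -> R) (v : nat -> R) :
  (forall n, `|c n| <= v n) -> cvgn (series v) -> cvgn (series c).
Proof.
move=> cv sv; apply: normed_cvg; apply: series_le_cvg sv => // n.
  exact: normr_ge0.
by apply: (le_trans _ (cv n)); exact: normr_ge0.
Qed.

(** Convergence is obtained separately for the real and the imaginary parts; the
    bound on the remainder then passes to the limit from finite blocks. *)
Lemma series_dominated c (v : nat -> R) :
  (forall n, normc (c n) <= v n) -> cvgn (series v) ->
  cvgn (series c) /\
  forall N, normc (limn (series c) - series c N) <= limn (series v) - series v N.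
Proof.
move=> cv sv.
have v0 n : 0 <= v n by apply: (le_trans _ (cv n)); exact: normc_ge0.
have cre : cvgn (series (fun n => complex.Re (c n))).
  apply: (@real_series_dominated _ v) => // n.
  exact: le_trans (le_Re_normc _) (cv n).
have cim : cvgn (series (fun n => complex.Im (c n))).
  apply: (@real_series_dominated _ v) => // n.
  exact: le_trans (le_Im_normc _) (cv n).
have cc : cvgn (series c).
  have : series c = (fun n => series (fun n => complex.Re (c n)) n +i*
     series (fun n => complex.Im (c n)) n).
    apply/funext => n; rewrite /series/= -Re_sum -Im_sum.
    by case: (\sum_(_ <= _ < _) _).
  move->; apply/cvg_ex; eexists; exact: cvg_ReIm cre cim.
split=> // N; apply/ler_addgt0Pr => e e0.
move/cvg_normcP: (cc) => /(_ e e0) [m _ hm].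
have /hm := leq_maxl m N; set k := maxn m N => hk.
rewrite -(subrK (series c k) (limn (series c))) -addrA addrC.
rewrite (le_trans (le_normcD _ _))// lerD//; last exact: ltW.
rewrite sub_series_geq ?leq_maxr// (le_trans (le_normc_sum _ _ _))//.
apply: (@le_trans _ _ (series v k - series v N)).
  by rewrite sub_series_geq ?leq_maxr// ler_sum.
by rewrite lerD2r series_le_limn.
Qed.

Lemma coupling_approx a (x : nat -> R[i]) N : ell1 a ->
  (forall n, normc (x n) <= 1) ->
  normc (coupling a x - \sum_(n < N) x n * a n) <= l1_tail a N.
Proof.
move=> la x1.
have [|_ /(_ N)] := @series_dominated (fun n => x n * a n)
  (fun n => normc (a n)) _ (ell1_cvg la).
  by move=> n; rewrite normcM ler_piMl ?normc_ge0.
by rewrite {2}/series/= big_mkord.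
Qed.

Lemma cvg_coupling a (x : nat -> R[i]) : ell1 a ->
  (forall n, normc (x n) <= 1) ->
  series (fun n => x n * a n) @ \oo --> coupling a x.
Proof.
move=> la x1.
have [|//] := @series_dominated (fun n => x n * a n)
  (fun n => normc (a n)) _ (ell1_cvg la).
by move=> n; rewrite normcM ler_piMl ?normc_ge0.
Qed.

Lemma power_sumE a z : power_sum a z = coupling a (phi z).
Proof.
rewrite /power_sum /coupling; congr (limn (series _)).
by apply/funext => n; rewrite mulrC.
Qed.

Lemma normc_phi_le1 z n : normc z <= 1 -> normc (phi z n) <= 1.
Proof. by move=> z1; rewrite normcX exprn_ile1// normc_ge0. Qed.

Lemma power_sum_approx a N z : ell1 a -> normc z <= 1 ->
  normc (power_sum a z - \sum_(n < N) a n * z ^+ n) <= l1_tail a N.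
Proof.
move=> la z1; rewrite power_sumE (eq_bigr (fun n : 'I_N => phi z n * a n)).
  by apply: coupling_approx => // n; exact: normc_phi_le1.
by move=> n _; rewrite mulrC.
Qed.

Lemma normc_subX z w n : normc z <= 1 -> normc w <= 1 ->
  normc (z ^+ n - w ^+ n) <= n%:R * normc (z - w).
Proof.
move=> z1 w1; elim: n => [|n IH]; first by rewrite !expr0 subrr normc0 mul0r.
have -> : z ^+ n.+1 - w ^+ n.+1 = z * (z ^+ n - w ^+ n) + (z - w) * w ^+ n.
  by rewrite !exprS; ring.
rewrite (le_trans (le_normcD _ _))// -natr1 [leRHS]mulrDl mul1r !normcM lerD//.
  by rewrite (le_trans _ IH)// ler_piMl ?normc_ge0.
by rewrite ler_piMr ?normc_ge0// normcX exprn_ile1// normc_ge0.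
Qed.

(** The partial sums are Lipschitz on the closed disc and the remainders are
    uniformly small there. *)
Lemma power_sum_unif_continuous a (e : R) : ell1 a -> 0 < e ->
  exists2 d : R, 0 < d & forall z w, normc z <= 1 -> normc w <= 1 ->
    normc (z - w) < d -> normc (power_sum a z - power_sum a w) < e.
Proof.
move=> la e0.
have e40 : 0 < e / 4 by rewrite divr_gt0.
have [N hN] : exists N, l1_tail a N < e / 4.
  have /cvgrPdist_lt/(_ _ e40)[N _ /(_ N (leqnn N))] := l1_tail_cvg la.
  by rewrite sub0r normrN ger0_norm ?l1_tail_ge0// => ?; exists N.
pose S := \sum_(n < N) normc (a n) * n%:R.
have S0 : 0 <= S by apply: sumr_ge0 => n _; rewrite mulr_ge0 ?normc_ge0.
have S10 : 0 < S + 1 by rewrite ltr_wpDl.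
exists (e / 4 / (S + 1)); first by rewrite divr_gt0.
move=> z w z1 w1; rewrite ltr_pdivlMr// => zw.
pose p u := \sum_(n < N) a n * u ^+ n.
have -> : power_sum a z - power_sum a w =
   (power_sum a z - p z) + ((p z - p w) + (p w - power_sum a w)).
  by rewrite addrA subrKA subrKA.
apply: (le_lt_trans (le_normcD _ _)).
apply: (@le_lt_trans _ _ (l1_tail a N + (e / 4 + l1_tail a N))); last lra.
apply: lerD; first exact: power_sum_approx.
apply: (le_trans (le_normcD _ _)); apply: lerD; last first.
  by rewrite normcB; exact: power_sum_approx.
apply: (le_trans _ (ltW zw)).
rewrite /p -sumrB (le_trans (le_normc_sum _ _ _))//.
apply: (@le_trans _ _ (normc (z - w) * S)); last first.
  by rewrite ler_wpM2l ?normc_ge0// lerDl.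
rewrite mulr_sumr ler_sum// => n _; rewrite -mulrBr normcM mulrCA.
by rewrite ler_wpM2l ?normc_ge0// mulrC normc_subX.
Qed.

(** A point of the closed disc is moved into the open one by a homothety of ratio
    close to 1, which changes the value as little as desired. *)
Lemma power_sum_le_closed_disc a (M : R) : ell1 a ->
  (forall z, normc z < 1 -> normc (power_sum a z) <= M) ->
  forall z, normc z <= 1 -> normc (power_sum a z) <= M.
Proof.
move=> la fM z z1; apply/ler_addgt0Pr => e e0.
have [d d0 hd] := power_sum_unif_continuous la e0.
pose h : R := Num.min (d / 2) (1 / 2).
have h0 : 0 < h by rewrite lt_min !divr_gt0.
have hd2 : h <= d / 2 by rewrite ge_min lexx.
have h12 : h <= 1 / 2 by rewrite ge_min lexx orbT.
have rz : normc ((1 - h)%:C * z) < 1.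
  rewrite normcM normc_real ger0_norm; last by lra.
  by apply: (@le_lt_trans _ _ (1 - h)); [rewrite ler_piMr//; lra | lra].
have zrz : normc (z - (1 - h)%:C * z) < d.
  rewrite -{1}[z]mul1r -mulrBl normcM -(rmorph1 (real_complex R)) -rmorphB normc_real.
  rewrite subKr ger0_norm ?(ltW h0)//.
  by apply: (@le_lt_trans _ _ (d / 2)); [rewrite (le_trans _ hd2)// ler_piMr// ltW | lra].
have := hd _ _ z1 (ltW rz) zrz; have := fM _ rz.
by have := le_normcB (power_sum a z) (power_sum a ((1 - h)%:C * z)); lra.
Qed.

End PowerSums.

(** * The circle and the roots of unity *)

Section UnitCircle.
Variable R : realType.
Implicit Types (x y e : R).

Definition cis x : R[i] := cos x +i* sin x.

Lemma cis0 : cis 0 = 1.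
Proof. by rewrite /cis cos0 sin0. Qed.

Lemma normc_cis x : normc (cis x) = 1.
Proof. by rewrite /= cos2Dsin2 sqrtr1. Qed.

Lemma cisD x y : cis (x + y) = cis x * cis y.
Proof.
rewrite /cis cosD sinD; apply/eqP.
by rewrite eq_complex/= eqxx/= addrC (mulrC (sin x)) eqxx.
Qed.

Lemma cisX x n : cis x ^+ n = cis (n%:R * x).
Proof.
elim: n => [|n IH]; first by rewrite expr0 mul0r cis0.
by rewrite exprS IH -cisD -natr1 mulrDl mul1r addrC.
Qed.

Lemma cis_2pi : cis (2 * pi) = 1.
Proof. by rewrite mulr_natl /cis cos2pi sin2pi. Qed.

Lemma lipschitz_of_derive_le1 (f df : R -> R) x y :
  (forall t : R, is_derive t 1 f (df t)) -> (forall t, `|df t| <= 1) ->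
  `|f x - f y| <= `|x - y|.
Proof.
move=> fdf df1; wlog xy : x y / x < y.
  move=> H; case: (ltgtP x y) => [|/H|->]; first exact: H.
    by rewrite distrC (distrC y).
  by rewrite !subrr.
have fd t : t \in `]x, y[ -> is_derive t 1 f (df t) by move=> _; exact: fdf.
have fc : {within `[x, y], continuous f}.
  apply: derivable_within_continuous => t _.
  exact: (@ex_derive _ _ _ _ _ _ _ (fdf t)).
have [c _ h] := MVT xy fd fc.
by rewrite distrC (distrC x) h normrM ler_piMl.
Qed.

(** Each of the two coordinates is 1-Lipschitz. *)
Lemma cis_lipschitz x y : normc (cis x - cis y) <= 2 * `|x - y|.
Proof.
apply: (le_trans (le_normc_ReIm _)); rewrite mulr_natl mulr2n lerD//=.
  apply: (@lipschitz_of_derive_le1 cos (fun t => - sin t)) => t.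
  by rewrite normrN sin_max.
apply: (@lipschitz_of_derive_le1 sin cos) => t.
exact: cos_max.
Qed.

(** The sine vanishes only at [pi] inside the open interval, and there the cosine
    is -1. *)
Lemma cis_eq1 x : 0 < x < 2 * pi -> cis x <> 1.
Proof.
move=> /andP[x0 x2] [c1 s0].
have pi0 := pi_gt0 R.
case: (ltgtP x pi) => [xp|px|xp].
- by have := @sin_gt0_pi R x; rewrite x0 xp s0 ltxx => /(_ isT).
- have := @sin_gt0_pi R (x - pi).
  have -> : sin (x - pi) = - sin x by rewrite -[in RHS](subrK pi x) sinDpi opprK.
  by rewrite s0 oppr0 ltxx subr_gt0 px ltrBlDr -mulr2n -mulr_natl x2 => /(_ isT).
- by move: c1; rewrite xp cospi => /eqP; rewrite -subr_eq0 -opprD oppr_eq0 => /eqP; lra.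
Qed.

(** The points [mesh N 0, ..., mesh N N] cut the interval from 0 to [2 pi] into
    [N] equal cells; their images on the circle are the [N]-th roots of unity. *)
Definition mesh M i : R := 2 * pi * i%:R / M%:R.

Lemma mesh0 M : mesh M 0 = 0.
Proof. by rewrite /mesh mulr0 mul0r. Qed.

Lemma mesh_last M : (0 < M)%N -> mesh M M = 2 * pi.
Proof. by move=> M0; rewrite /mesh mulfK// pnatr_eq0 -lt0n. Qed.

Lemma mesh_step M i : mesh M i.+1 - mesh M i = 2 * pi / M%:R.
Proof. by rewrite /mesh -mulrBl -mulrBr -[i.+1%:R]natr1 addrAC subrr add0r mulr1. Qed.

Lemma mesh_le M i j : (i <= j)%N -> mesh M i <= mesh M j.
Proof.
move=> ij; rewrite ler_wpM2r ?invr_ge0// ler_wpM2l ?ler_nat// mulr_ge0//.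
exact: pi_ge0.
Qed.

Definition unit_root N : R[i] := cis (2 * pi / N%:R).

Lemma unit_rootX N j : unit_root N ^+ j = cis (mesh N j).
Proof. by rewrite cisX /mesh; congr cis; rewrite mulrCA mulrA mulrAC. Qed.

Lemma normc_unit_root N : normc (unit_root N) = 1.
Proof. exact: normc_cis. Qed.

Lemma unit_root_prim N : (0 < N)%N -> N.-primitive_root (unit_root N).
Proof.
move=> N0; apply/andP; split=> //; apply/forallP => /= i; apply/eqP.
have pi0 : 0 < 2 * pi :> R by rewrite mulr_gt0// pi_gt0.
have NR : 0 < N%:R :> R by rewrite ltr0n.
rewrite unity_rootE unit_rootX /mesh; apply/idP/idP => [/eqP h|/eqP->]; last first.
  by rewrite mulfK ?lt0r_neq0// cis_2pi.
apply: contrapT => /negP iN; have {iN}iN : (i.+1 < N)%N by rewrite ltn_neqAle iN ltn_ord.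
apply: (@cis_eq1 _ _ h); rewrite divr_gt0 ?mulr_gt0 ?ltr0n ?pi_gt0//=.
by rewrite ltr_pdivrMr// ltr_pM2l// ltr_nat.
Qed.

(** The factorization of [X^N - 1], evaluated at [alpha / x]. *)
Lemma prod_unit_root N (x alpha : R[i]) : (0 < N)%N -> x != 0 ->
  \prod_(j < N) (x * unit_root N ^+ j - alpha) = (- x) ^+ N * ((alpha / x) ^+ N - 1).
Proof.
move=> N0 x0; have := congr1 (horner^~ (alpha / x)) (factor_Xn_sub_1 (unit_root_prim N0)).
rewrite hornerD hornerN hornerXn hornerC => <-; rewrite big_mkord.
rewrite horner_prod -[in (- x) ^+ N](card_ord N) -prodr_const -big_split/=.
apply: eq_bigr => j _; rewrite hornerXsubC mulrBr mulNr mulrCA divff// mulr1 mulNr opprK.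
by rewrite addrC.
Qed.

Lemma normc_prod_unit_root N (r : R) (alpha : R[i]) : (0 < N)%N -> 0 < r ->
  normc (\prod_(j < N) (r%:C * unit_root N ^+ j - alpha)) =
  normc (alpha ^+ N - r%:C ^+ N).
Proof.
move=> N0 r0; have r0' : r%:C != 0 by rewrite eq_complex/= eqxx andbT gt_eqF.
rewrite prod_unit_root// normcM normcX normcN -normcX -normcM; congr normc.
by rewrite exprMn exprVn mulrBr mulrCA divff ?mulr1// expf_neq0.
Qed.

End UnitCircle.
Arguments mesh {R} M i.

(** * A geometric mean inequality for polynomials *)

Section SmallCells.
Variable R : realType.
Implicit Types (a : nat -> R[i]) (r s t e : R).

Lemma near_expr_le_half s t : 0 <= s < t ->
  \forall N \near \oo, s ^+ N <= t ^+ N / 2.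
Proof.
move=> /andP[s0 st]; have t0 : 0 < t by exact: le_lt_trans st.
have q1 : `|s / t| < 1 by rewrite ger0_norm ?divr_ge0 ?(ltW t0)// ltr_pdivrMr// mul1r.
have half0 : 0 < 1 / 2 :> R by rewrite divr_gt0.
have /cvgrPdist_lt/(_ _ half0) := cvg_expr q1.
apply: filterS => N; rewrite sub0r normrN ger0_norm ?exprn_ge0 ?divr_ge0 ?(ltW t0)//.
rewrite expr_div_n => /ltW; rewrite ler_pdivrMr ?exprn_gt0// => /le_trans; apply.
by rewrite mulrC mul1r.
Qed.

(** The power with the larger base eventually is at least twice the other one. *)
Lemma near_root_dist r (alpha : R[i]) : 0 < r -> normc alpha != r ->
  \forall N \near \oo, normc alpha ^+ N <= 2 * normc (alpha ^+ N - r%:C ^+ N).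
Proof.
move=> r0; have h0 := normc_ge0 alpha.
have rN N : normc (r%:C ^+ N) = r ^+ N.
  by rewrite normcX normc_real ger0_norm// ltW.
case: (ltgtP (normc alpha) r) => // h _.
  have : 0 <= normc alpha < r by rewrite h0.
  move=> /near_expr_le_half; apply: filterS => N hN.
  rewrite normcB; have := le_normcB (r%:C ^+ N) (alpha ^+ N).
  by rewrite rN normcX; have := exprn_ge0 N h0; lra.
have : 0 <= r < normc alpha by rewrite ltW.
move=> /near_expr_le_half; apply: filterS => N hN.
have := le_normcB (alpha ^+ N) (r%:C ^+ N).
by rewrite rN normcX; lra.
Qed.

Lemma near_prod_root_dist r (rs : seq R[i]) : 0 < r ->
  r \notin [seq normc z | z <- rs] ->
  \forall N \near \oo, \prod_(z <- rs) normc z ^+ N <=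
     2 ^+ size rs * \prod_(z <- rs) normc (z ^+ N - r%:C ^+ N).
Proof.
move=> r0; elim: rs => [_|z rs IH].
  by near=> N; rewrite !big_nil mulr1.
rewrite /= inE negb_or => /andP[rz /IH]; rewrite eq_sym in rz.
move: (near_root_dist r0 rz); apply: filterS2 => N h1 h2.
rewrite !big_cons exprS mulrACA ler_pM//.
  by rewrite exprn_ge0// normc_ge0.
by apply: prodr_ge0 => *; rewrite exprn_ge0// normc_ge0.
Unshelve. all: by end_near.
Qed.

(** A discrete form of Jensen's inequality.  By [normc_prod_unit_root], the
    product of the moduli of [p] over [N] equally spaced points of the circle of
    radius [r] splits into one factor per root of [p], and none of these factors
    is much smaller than the [N]-th power of the modulus of the root.  The
    finitely many excluded radii are the moduli of the roots, for which a factor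
    may vanish; the constant [2 ^ d] does not grow with [N]. *)
Lemma near_geometric_mean (p : {poly R[i]}) :
  exists rs : seq R, forall r, 0 < r -> r \notin rs ->
  exists d, \forall N \near \oo,
   normc p.[0] ^+ N <= 2 ^+ d * \prod_(j < N) normc p.[r%:C * unit_root R N ^+ j].
Proof.
have [rs ->] := closed_field_poly_normal p.
exists [seq normc z | z <- rs] => r r0 /(near_prod_root_dist r0) H.
exists (size rs); near=> N.
have N0 : (0 < N)%N by near: N; exists 1%N.
have : \prod_(z <- rs) normc z ^+ N <=
     2 ^+ size rs * \prod_(z <- rs) normc (z ^+ N - r%:C ^+ N) by near: N.
move=> /(ler_wpM2l (exprn_ge0 N (normc_ge0 (lead_coef p)))) => h.
have -> : normc (lead_coef p *: \prod_(z <- rs) ('X - z%:P)).[0] ^+ N =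
  normc (lead_coef p) ^+ N * \prod_(z <- rs) normc z ^+ N.
  rewrite hornerZ normcM exprMn horner_prod normc_prod -prodrXl.
  by congr (_ * _); apply: eq_bigr => z _; rewrite hornerXsubC sub0r normcN.
apply: (le_trans h); rewrite mulrCA ler_wpM2l ?exprn_ge0//.
have -> : \prod_(j < N) normc (lead_coef p *:
      \prod_(z <- rs) ('X - z%:P)).[r%:C * unit_root R N ^+ j] =
    normc (lead_coef p) ^+ N * \prod_(z <- rs) normc (z ^+ N - r%:C ^+ N).
  under [LHS]eq_bigr do rewrite hornerZ horner_prod normcM normc_prod.
  rewrite big_split/= prodr_const card_ord exchange_big/=; congr (_ * _).
  apply: eq_bigr => z _; rewrite -normc_prod_unit_root// normc_prod.
  by apply: eq_bigr => j _; rewrite hornerXsubC.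
by [].
Unshelve. all: by end_near.
Qed.

End SmallCells.

(** * Zeros of a power series on the circle *)

Section ZeroCells.
Variable R : realType.
Implicit Types (a : nat -> R[i]) (r s t e : R).

Lemma avoid_seq (rs : seq R) s t : s < t ->
  exists r, [/\ s < r, r < t & r \notin rs].
Proof.
elim: rs s t => [|x rs IH] s t st; first by exists ((s + t) / 2); split=> //; lra.
have [xm|mx] := ltP x ((s + t) / 2).
  have [|r [h1 h2 h3]] := IH ((s + t) / 2) t; first lra.
  by exists r; split=> //; [lra | rewrite inE negb_or h3 andbT gt_eqF//; lra].
have [|r [h1 h2 h3]] := IH s ((s + t) / 2); first lra.
by exists r; split=> //; [lra | rewrite inE negb_or h3 andbT lt_eqF//; lra].
Qed.

(** If the cells of [J] contain zeros of the power sum [f], then [f], hence also a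
    partial sum [p] of [f], is small near the corresponding roots of unity.  The
    points at which [near_geometric_mean] is applied to [p] are pulled slightly
    into the disc, onto a circle without roots of [p].  If [#|J|]
    exceeded [N / K], the small values would outweigh the bound [M] at the other
    points. *)
Lemma few_zero_cells a K : ell1 a -> a 0%N != 0 -> (0 < K)%N ->
  exists2 N, (0 < N)%N & forall J : {set 'I_N},
   (forall j, j \in J -> exists2 t, `|t - mesh N j| <= 2 * pi / N%:R &
      power_sum a (cis t) = 0) -> (K * #|J| <= N)%N.
Proof.
move=> la a0 K0.
pose A := normc (a 0%N); pose M := limn (series (fun n => normc (a n))).
have A0 : 0 < A by rewrite lt_def normc_ge0 normc_eq0 a0.
have pM r n : 0 <= r <= 1 -> \sum_(k < n) normc (a k) * r ^+ k <= M.
  move=> /andP[r0 r1]; apply: (@le_trans _ _ (series (fun n => normc (a n)) n)).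
    rewrite /series/= big_mkord ler_sum// => k _.
    by rewrite ler_piMr ?normc_ge0// exprn_ile1.
  by apply: series_le_limn (ell1_cvg la) => k; exact: normc_ge0.
have AM : A <= M.
  by have := pM 0 1%N; rewrite big_ord1 expr0 mulr1 lexx ler01 => ->.
have M0 : 0 < M by exact: lt_le_trans AM.
(* With [x := q ^+ K], more than [N / K] values of modulus at most [M * x]
   bring the product over [N] points down to [(A / 4) ^+ N] at most. *)
pose q := A / (4 * M); pose x := q ^+ K.
have q0 : 0 < q by rewrite divr_gt0 ?mulr_gt0.
have q1 : q <= 1 by rewrite ler_pdivrMr ?mulr_gt0//; lra.
have x0 : 0 < x by rewrite exprn_gt0.
pose dl := M * x / 2.
have dl0 : 0 < dl by rewrite divr_gt0 ?mulr_gt0.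
have [d d0 fd] := power_sum_unif_continuous la dl0.
have [n n0 hn] : exists2 n, (0 < n)%N & l1_tail a n < dl.
  have /cvgrPdist_lt/(_ _ dl0)[n _ hn] := l1_tail_cvg la.
  exists n.+1 => //; have := hn n.+1 (leqnSn n).
  by rewrite sub0r normrN ger0_norm ?l1_tail_ge0.
pose p : {poly R[i]} := \poly_(k < n) a k.
have pE z : p.[z] = \sum_(k < n) a k * z ^+ k by rewrite horner_poly.
have p0 : p.[0] = a 0%N.
  case: n n0 @p pE {hn} => // n _ p ->; rewrite big_ord_recl expr0 mulr1 big1 ?addr0//.
  by move=> k _; rewrite expr0n mulr0.
have [rs hrs] := near_geometric_mean p.
have [r [r1 r2 rrs]] : exists r, [/\ Num.max 0 (1 - d / 2) < r, r < 1 & r \notin rs].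
  by apply: avoid_seq; rewrite gt_max ltr01; lra.
move: r1; rewrite gt_max => /andP[r0 r1].
have [dg gm] := hrs r r0 rrs.
have [N [N0 Nd Nmesh gmN]] : exists N, [/\ (0 < N)%N, (dg <= N)%N,
    4 * pi / N%:R < d / 2 &
    normc p.[0] ^+ N <= 2 ^+ dg * \prod_(j < N) normc p.[r%:C * unit_root R N ^+ j]].
  near \oo => N; exists N; split; near: N; last exact: gm.
  - by exists 1%N.
  - by exists dg.
  - have pi0 := pi_gt0 R.
    exists (Num.truncn (8 * pi / d)).+1 => // N /= hN.
    have hN' : 8 * pi / d < N%:R.
      by apply: (lt_le_trans (truncnS_gt _)); rewrite ler_nat.
    have NR : 0 < N%:R :> R by apply: le_lt_trans hN'; rewrite divr_ge0 ?mulr_ge0// ltW.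
    rewrite ltr_pdivrMr//; move: hN'; rewrite ltr_pdivrMr//; lra.
exists N => // J hJ; rewrite leqNgt; apply/negP => hK.
pose g (j : 'I_N) := p.[r%:C * unit_root R N ^+ j].
have nr (j : 'I_N) : normc (r%:C * unit_root R N ^+ j) = r.
  by rewrite normcM normc_real normcX normc_unit_root expr1n mulr1 gtr0_norm.
have gM (j : 'I_N) : normc (g j) <= M.
  rewrite /g pE; apply: (le_trans (le_normc_sum _ _ _)).
  under eq_bigr do rewrite normcM normcX nr.
  by apply: pM; rewrite !ltW.
have gJ (j : 'I_N) : j \in J -> normc (g j) <= M * x.
  move=> /hJ[t tj ft].
  have h1 : normc (cis t - r%:C * unit_root R N ^+ j) < d.
    rewrite -(subrKA (unit_root R N ^+ j)); apply: (le_lt_trans (le_normcD _ _)).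
    rewrite -{2}[unit_root R N ^+ j]mul1r -mulrBl [normc (_ * _)]normcM.
    rewrite normcX normc_unit_root expr1n mulr1.
    have -> : 1 - r%:C = (1 - r)%:C by rewrite rmorphB.
    rewrite normc_real gtr0_norm ?subr_gt0//.
    suff : normc (cis t - unit_root R N ^+ j) < d / 2 by lra.
    rewrite unit_rootX; apply: (le_lt_trans (cis_lipschitz _ _)).
    by apply: le_lt_trans Nmesh; move: tj; lra.
  have := fd (cis t) (r%:C * unit_root R N ^+ j).
  rewrite normc_cis nr lexx (ltW r2) h1 ft sub0r normcN => /(_ isT isT isT) h2.
  have := @power_sum_approx R a n (r%:C * unit_root R N ^+ j) la.
  rewrite nr (ltW r2) -pE -/(g j) normcB => /(_ isT) h3.
  have := le_normcB (g j) (power_sum a (r%:C * unit_root R N ^+ j)).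
  by rewrite /dl in hn h2; lra.
have prodg : \prod_(j < N) normc (g j) <= M ^+ N * x ^+ #|J|.
  have -> : M ^+ N = \prod_(j < N) M by rewrite prodr_const card_ord.
  rewrite -prodr_const [X in _ * X]big_mkcond -big_split/=; apply: ler_prod => j _.
  rewrite normc_ge0/=; case: ifPn => jJ; last by rewrite mulr1 gM.
  exact: gJ.
have xq : x ^+ #|J| <= q ^+ N.
  by rewrite -exprM; apply: ler_wiXn2l => //; [exact: ltW|exact: ltnW].
have : A ^+ N <= 2 ^+ dg * (M ^+ N * q ^+ N).
  move: gmN; rewrite p0 => /le_trans; apply; rewrite ler_wpM2l ?exprn_ge0//.
  apply: (le_trans prodg); rewrite ler_wpM2l// exprn_ge0// ltW//.
have -> : M ^+ N * q ^+ N = A ^+ N / 4 ^+ N.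
  by rewrite -exprMn -expr_div_n; congr (_ ^+ _); rewrite /q; field; rewrite gt_eqF.
rewrite mulrCA -[leLHS]mulr1 ler_pM2l ?exprn_gt0// ler_pdivlMr ?exprn_gt0// mul1r.
(* [N] was taken at least [dg], so that [4 ^+ N <= 2 ^+ dg] is absurd. *)
have h4 : 2 ^+ dg <= 2 ^+ N :> R by rewrite ler_eXn2l// ltr1n.
move=> /le_trans/(_ h4); rewrite leNgt => /negP; apply; rewrite ltr_pXn2r ?nnegrE//; lra.
Unshelve. all: by end_near.
Qed.

End ZeroCells.

(** * Level sets on the circle have measure zero *)

Section NullLevelSets.
Variable R : realType.
Implicit Types (a : nat -> R[i]) (r s t e : R).

Lemma cvg_ell1 a : cvgn (series (fun n => normc (a n))) -> ell1 a.
Proof.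
move=> ca; rewrite /ell1/= /summable.
rewrite -[X in esum X _](_ : [set x | predT x] = _); last by apply/seteqP.
rewrite -nneseries_esum; last by move=> n _; exact: abse_ge0.
rewrite (_ : (fun n => _) = EFin \o series (fun n => normc (a n))).
  by rewrite EFin_lim// ltry.
apply/funext => n; rewrite /= -sumEFin; apply: eq_bigr => k _.
by rewrite ger0_norm// normc_ge0.
Qed.

Lemma cvg_power_sum a z : ell1 a -> normc z <= 1 ->
  (fun N => \sum_(n < N) a n * z ^+ n) @ \oo --> power_sum a z.
Proof.
move=> la z1; have := @cvg_coupling R a (phi z) la (fun n => normc_phi_le1 n z1).
rewrite -power_sumE; apply: cvg_trans; apply: near_eq_cvg; near=> N.
by rewrite /series/= big_mkord; apply: eq_bigr => n _; rewrite mulrC.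
Unshelve. all: by end_near.
Qed.

Lemma cvg_power_sum_unique a z l : ell1 a -> normc z <= 1 ->
  (fun N => \sum_(n < N) a n * z ^+ n) @ \oo --> l -> power_sum a z = l.
Proof.
by move=> la z1; apply: cvg_unique; [exact: norm_hausdorff | exact: cvg_power_sum].
Qed.

Definition sub_const a (beta : R[i]) n := if n == 0%N then a 0%N - beta else a n.

Lemma ell1_sub_const a beta : ell1 a -> ell1 (sub_const a beta).
Proof.
move=> /ell1_cvg la; apply/cvg_ell1; rewrite -(is_cvg_series_restrict 1).
rewrite (_ : (fun n => _) = fun n => \sum_(1 <= k < n) normc (a k)).
  by rewrite is_cvg_series_restrict.
by apply/funext => n; apply: eq_big_nat => -[].
Qed.

Lemma power_sum_sub_const a beta z : ell1 a -> normc z <= 1 ->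
  power_sum (sub_const a beta) z = power_sum a z - beta.
Proof.
move=> la z1; apply: cvg_power_sum_unique => //; first exact: ell1_sub_const.
apply: cvg_trans (cvgB (cvg_power_sum la z1) (cvg_cst beta)).
apply: near_eq_cvg; near=> N.
have N0 : (0 < N)%N by near: N; exists 1%N.
rewrite -(prednK N0) -[LHS]/(\sum_(n < _) a n * z ^+ n - beta).
by rewrite !big_ord_recl/= /sub_const eqxx !expr0 !mulr1 addrAC.
Unshelve. all: by end_near.
Qed.

Lemma ell1_shift a m : ell1 a -> ell1 (fun n => a (n + m)%N).
Proof.
move=> /ell1_cvg la; apply/cvg_ell1; move: la; rewrite -(is_cvg_series_restrict m).
move=> /cvg_ex[l hl]; apply/cvg_ex; exists l.
rewrite -(cvg_shiftn m) in hl; apply: cvg_trans hl.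
apply: near_eq_cvg; near=> N => /=.
by rewrite /series/= -{1}[m]add0n big_addn addnK.
Unshelve. all: by end_near.
Qed.

Lemma power_sum_shift a m z : ell1 a -> normc z <= 1 ->
  (forall n, (n < m)%N -> a n = 0) ->
  power_sum a z = z ^+ m * power_sum (fun n => a (n + m)%N) z.
Proof.
move=> la z1 am; apply: cvg_power_sum_unique => //.
rewrite -(cvg_shiftn m).
apply: cvg_trans (cvgM (cvg_cst (z ^+ m)) (cvg_power_sum (ell1_shift m la) z1)).
apply: near_eq_cvg; near=> N => /=.
rewrite -[RHS](big_mkord predT (fun n => a n * z ^+ n)).
rewrite (@big_cat_nat _ _ _ m) ?leq_addl//=.
rewrite [X in _ = X + _]big_nat [X in _ = X + _]big1 ?add0r; last first.
  by move=> n /andP[_ nm]; rewrite am// mul0r.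
rewrite -[RHS]/(\sum_(0 + m <= i < N + m) a i * z ^+ i).
rewrite big_addn addnK big_mkord mulr_sumr; apply: eq_bigr => n _.
by rewrite mulrCA exprD (mulrC (z ^+ n)).
Unshelve. all: by end_near.
Qed.

Lemma cis_power_sum_continuous a : ell1 a ->
  continuous (fun t : R => normc (power_sum a (cis t))).
Proof.
move=> la t; apply/cvgrPdist_lt => e e0.
have [d d0 hd] := power_sum_unif_continuous la e0.
have d2 : 0 < d / 2 by rewrite divr_gt0.
near=> s; have ts : `|t - s| < d / 2.
  by near: s; apply: cvgr_dist_lt => //; exact: cvg_id.
have h : normc (cis t - cis s) < d.
  by apply: (le_lt_trans (cis_lipschitz _ _)); lra.
have := hd (cis t) (cis s); rewrite !normc_cis lexx => /(_ isT isT h).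
apply: le_lt_trans; rewrite ler_norml le_normcB andbT.
by rewrite lerNl opprB normcB le_normcB.
Unshelve. all: by end_near.
Qed.

Lemma zero_set_measurable a : ell1 a ->
  measurable [set t : R | 0 <= t < 2 * pi /\ power_sum a (cis t) = 0].
Proof.
move=> la.
rewrite (_ : [set t | _] = `[0, 2 * pi[%classic `&`
   (fun t : R => normc (power_sum a (cis t))) @^-1` [set 0]).
  apply: measurableI => //; apply: measurable_realfun.closed_measurable.
  apply: preimage_closed.
    by move=> t _; exact: (cis_power_sum_continuous la).
  exact: (@closed_eq _ 0).
apply/seteqP; split => t /=; rewrite in_itv/= => -[h1 h2]; split=> //.
  by rewrite h2 normc0.
exact: eq0_normc.
Qed.

(** By [few_zero_cells] the zeros are covered by cells of arbitrarily small total
    length. *)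
Lemma null_zero_set a : ell1 a -> a 0%N != 0 ->
  lebesgue_measure [set t : R | 0 <= t < 2 * pi /\ power_sum a (cis t) = 0] = 0%E.
Proof.
move=> la a0; set Z := [set t | _].
have mZ : measurable Z by exact: zero_set_measurable.
have pi0 : 0 < 2 * pi :> R by rewrite mulr_gt0// pi_gt0.
suff H K : (0 < K)%N -> (lebesgue_measure Z <= (2 * pi / K%:R)%:E)%E.
  apply/eqP; rewrite eq_le measure_ge0 andbT; apply/lee_addgt0Pr => e e0.
  rewrite add0e (le_trans (H (Num.truncn (2 * pi / e)).+1 _))// lee_fin.
  rewrite ler_pdivrMr ?ltr0n// (mulrC e) -ler_pdivrMr//.
  exact/ltW/truncnS_gt.
move=> K0; have [N N0 hN] := few_zero_cells la a0 K0.
have NR : 0 < N%:R :> R by rewrite ltr0n.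
have KR : 0 < K%:R :> R by rewrite ltr0n.
pose cell j : set R := `[mesh N j, mesh N j.+1[%classic.
pose J : {set 'I_N} := finset (fun j : 'I_N => `[< exists2 t, cell j t & Z t >]).
have {}hN := hN J; have {}hN : (K * #|J| <= N)%N.
  apply: hN => j; rewrite inE => /asboolP[t]; rewrite /cell/= in_itv/=.
  move=> /andP[t1 t2] [_ Zt]; exists t => //; rewrite -(@mesh_step R N j).
  by rewrite ger0_norm ?subr_ge0// lerD2r ltW.
(* The cells of [J], extended by the empty set to a sequence of sets. *)
pose C j : set R :=
  if [exists k : 'I_N, (k == j :> nat) && (k \in J)] then cell j else set0.
have CE (j : 'I_N) : C j = if j \in J then cell j else set0.
  rewrite /C; case: ifPn => [/existsP[k /andP[/eqP/val_inj-> ->]]//|].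
  rewrite negb_exists => /forallP/(_ j); rewrite eqxx andTb.
  by case: ifP => // ->.
have ZC : Z `<=` \big[setU/set0]_(j < N) C j.
  move=> t Zt; have [/andP[t0 t2] _] := Zt.
  have tN0 : 0 <= t * N%:R / (2 * pi) by rewrite divr_ge0 ?(ltW pi0)// mulr_ge0// ltW.
  have /andP[j1 j2] := truncn_itv tN0.
  have jN : (Num.truncn (t * N%:R / (2 * pi)) < N)%N.
    rewrite -(ltr_nat R) (le_lt_trans j1)// ltr_pdivrMr// mulrC ltr_pM2l//.
  have tj : cell (Ordinal jN) t.
    rewrite /cell/= in_itv/= /mesh; apply/andP; split.
      by rewrite ler_pdivrMr// [leLHS]mulrC -ler_pdivlMr.
    by rewrite ltr_pdivlMr// [ltRHS]mulrC -ltr_pdivrMr.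
  rewrite -bigcup_mkord; exists (Num.truncn (t * N%:R / (2 * pi))) => //=.
  have -> := CE (Ordinal jN); rewrite ifT// inE; apply/asboolP.
  by exists t.
have mcell j : measurable (cell j) by exact: measurable_itv.
have mcellE j : lebesgue_measure (cell j) = (2 * pi / N%:R)%:E.
  rewrite lebesgue_measure_itv/= lte_fin -subr_gt0 mesh_step divr_gt0//.
  by rewrite -EFinB mesh_step.
have := @content_subadditive _ _ _ (@lebesgue_measure R) Z C N.
move=> /(_ _ mZ ZC) /le_trans; apply.
  by move=> j _; rewrite /C; case: ifP => // _; exact: mcell.
rewrite (eq_bigr (fun j : 'I_N => if j \in J then (2 * pi / N%:R)%:E else 0%E)).
  rewrite -big_mkcond/= sumEFin lee_fin sumr_const -[leLHS]mulr_natr.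
  rewrite -[leLHS]mulrA ler_pM2l// mulrC ler_pdivrMr// [leRHS]mulrC ler_pdivlMr//.
  by rewrite -natrM ler_nat mulnC.
by move=> j _; rewrite CE; case: ifP => _; [exact: mcellE | exact: measure0].
Qed.

Lemma level_set_measurable b beta : ell1 b ->
  measurable [set t : R | 0 <= t < 2 * pi /\ power_sum b (cis t) = beta].
Proof.
move=> lb; have := zero_set_measurable (ell1_sub_const beta lb).
congr measurable; apply/seteqP; split=> t /= [ht];
  rewrite power_sum_sub_const// ?normc_cis// => h; split=> //.
  by apply/eqP; rewrite -subr_eq0 h.
by rewrite h subrr.
Qed.

(** The power sum minus [beta] is a power of the variable, which does not vanish on
    the circle, times a power sum with non-zero constant term. *)
Lemma null_level_set b beta : ell1 b -> nontrivial b ->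
  lebesgue_measure [set t : R | 0 <= t < 2 * pi /\ power_sum b (cis t) = beta] = 0%E.
Proof.
move=> lb nb; pose a := sub_const b beta.
have [m am] : exists m, a m != 0.
  apply: contrapT => ha; apply: nb; exists (b 0%N); apply/funext => n.
  case: ifPn => [/eqP->//|n0]; apply: contrapT => /eqP bn; apply: ha; exists n.
  by rewrite /a /sub_const (negbTE n0).
have la : ell1 a by exact: ell1_sub_const.
have [k ak kmin] := ex_minnP (ex_intro (fun m => a m != 0) m am).
have ak0 n : (n < k)%N -> a n = 0.
  by move=> nk; apply/eqP; apply: contraLR nk => /kmin; rewrite -leqNgt.
have := null_zero_set (ell1_shift k la) ak.
congr (lebesgue_measure _ = _); apply/seteqP; split=> t /= [ht];
  have t1 : normc (cis t) <= 1 by rewrite normc_cis.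
  move=> h; split=> //; apply/eqP; rewrite -subr_eq0.
  by rewrite -power_sum_sub_const// -/a (power_sum_shift la t1 ak0) h mulr0.
move=> h; split=> //; apply/eqP.
have : power_sum a (cis t) == 0 by rewrite power_sum_sub_const// h subrr.
rewrite (power_sum_shift la t1 ak0) mulf_eq0 expf_eq0 -[cis t == 0]normc_eq0.
by rewrite normc_cis oner_eq0 andbF.
Qed.

(** The interval from 0 to [2 pi] is not null, so it is not the zero set. *)
Lemma nontrivial_neq0 b : ell1 b -> nontrivial b ->
  exists t, power_sum b (cis t) != 0.
Proof.
move=> lb nb; apply: contrapT => H; have := null_level_set 0 lb nb.
rewrite (_ : [set t | _] = `[0, 2 * pi[%classic).
  have pi0 : 0 < 2 * pi :> R by rewrite mulr_gt0// pi_gt0.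
  rewrite lebesgue_measure_itv/= lte_fin pi0 oppr0 adde0 => -[] /eqP.
  by rewrite gt_eqF.
apply/seteqP; split=> t /=; rewrite in_itv/=; first by case.
move=> ht; split=> //; apply: contrapT => /eqP ft.
by apply: H; exists t.
Qed.

End NullLevelSets.

(** * The closed convex hull of the geometric sequences *)

Section ClosedConvexHull.
Variable R : realType.
Implicit Types (x y : nat -> R[i]) (P : set (nat -> R[i])).

(** Induction along the construction of the set: generators, convex combinations,
    uniform limits. *)
Lemma S0_ind P :
  (forall l, normc l < 1 -> P (phi l)) ->
  (forall (s : R) x y, 0 <= s <= 1 -> P x -> P y ->
     P (fun n => s%:C * x n + (1 - s)%:C * y n)) ->
  (forall y, (forall e : R, 0 < e ->
     exists2 x, P x & forall n, normc (y n - x n) < e) -> P y) ->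
  forall y, @S0 R y -> P y.
Proof.
move=> Pphi Pconv Pclos y [_ cy]; apply: Pclos => e e0.
have [] := cy [set z | forall n, normc (y n - z n) < e].
  apply/uniform_nbhs.
  exists [set uv | ball uv.1 e%:C uv.2]; split.
    by rewrite -entourage_from_ballE; exists e%:C => //=; rewrite ltcR.
  by move=> z /= hz n; have := hz n I; rewrite -ball_normE /= normr_normc ltcR.
move=> x [Sx hx]; exists x => //; apply: Sx; split; last first.
  by move=> _ [l /= l1 <-]; exact: Pphi.
move=> u v t; rewrite !inE => Pu Pv.
have : 0 <= t%:num <= 1 by rewrite ge0 le1.
rewrite !lecE/= => /andP[/andP[_ t0] /andP[t1i t1]].
have -> : conv t u v = fun n =>
    (complex.Re t%:num)%:C * u n + (1 - complex.Re t%:num)%:C * v n.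
  have tE : t%:num = (complex.Re t%:num)%:C.
    by apply/eqP; rewrite eq_complex/= eqxx/= eq_sym.
  apply/funext => n; rewrite -[LHS]/(t%:num * u n + (1 - t%:num) * v n).
  by rewrite rmorphB/= -tE.
by apply: Pconv => //; rewrite t0 t1.
Qed.

Lemma S0_phi (l : R[i]) : normc l < 1 -> @S0 R (phi l).
Proof.
move=> l1; split.
  apply/cvg_normcP => e e0.
  have /cvgrPdist_lt/(_ e e0) : (GRing.exp (normc l) : nat -> R) @ \oo --> 0.
    by apply: cvg_expr; rewrite ger0_norm ?normc_ge0.
  apply: filterS => n; rewrite !sub0r normrN normcN normcX ger0_norm//.
  by rewrite exprn_ge0 ?normc_ge0.
apply: subset_closure => A [_]; apply; by exists l.
Qed.

End ClosedConvexHull.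

(** * Discrete moments and the sampled Poisson kernel *)

Section DiscreteMoments.
Variable R : realType.
Implicit Types (x y : nat -> R[i]) (w : nat -> R) (l z : R[i]).

Definition moment N w n : R[i] := \sum_(j < N) (w j)%:C * unit_root R N ^+ j ^+ n.

(** The weights need not have total mass 1: their mass is the moment of order 0,
    which is controlled like the other moments.  Asking for weights at every
    large [N] provides two sequences with weights on common points, so that
    convex combinations can be formed. *)
Definition approximable y := forall m (e : R), 0 < e ->
  \forall N \near \oo, exists2 w, (forall j, 0 <= w j) &
    forall n, (n <= m)%N -> normc (y n - moment N w n) < e.

(** The coordinate of index 0 will be the total mass of the representing measure. *)
Lemma S0_total_mass y : @S0 R y -> y 0%N = 1.
Proof.
apply: (@S0_ind R (fun y => y 0%N = 1)) => [l _|s u v _ -> ->|v hv].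
- exact: expr0.
- by rewrite !mulr1 -rmorphD/= addrC subrK.
- apply/eqP; rewrite -subr_eq0 -normc_eq0 eq_le normc_ge0 andbT.
  apply/ler_addgt0Pr => e e0; rewrite add0r.
  by have [u u0 /(_ 0%N)] := hv e e0; rewrite u0 => /ltW.
Qed.

Lemma S0_bounded y : @S0 R y -> forall n, normc (y n) <= 1.
Proof.
move=> Sy n; move: y Sy.
apply: (@S0_ind R (fun y => normc (y n) <= 1)) => [l l1|s u v /andP[s0 s1] hu hv|v hv].
- by apply: normc_phi_le1; exact: ltW.
- rewrite (le_trans (le_normcD _ _))// !normcM !normc_real !ger0_norm ?subr_ge0//.
  have := ler_wpM2l s0 hu; have : 0 <= 1 - s by lra.
  by move=> h; have := ler_wpM2l h hv; lra.
- apply/ler_addgt0Pr => e e0.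
  have [u u1 /(_ n)] := hv e e0; have := le_normcB (v n) (u n); lra.
Qed.

Lemma sum_unity_root N z : z ^+ N = 1 ->
  \sum_(j < N) z ^+ j = if z == 1 then N%:R else 0.
Proof.
case: ifPn => [/eqP-> _|z1 zN].
  by rewrite (eq_bigr (fun=> 1)) ?sumr_const ?card_ord// => j _; exact: expr1n.
apply/(mulfI (x := z - 1)); first by rewrite subr_eq0.
by rewrite -subrX1 zN subrr mulr0.
Qed.

Lemma geometric_unity N z : z ^+ N != 1 ->
  (1 - z)^-1 = (\sum_(m < N) z ^+ m) / (1 - z ^+ N).
Proof.
move=> zN; have z1 : 1 - z != 0.
  by apply: contra zN; rewrite subr_eq0 => /eqP <-; rewrite expr1n.
apply/(mulfI z1); rewrite divff// mulrA -opprB mulNr -subrX1 opprB divff//.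
by rewrite subr_eq0 eq_sym.
Qed.

(** The Poisson kernel of [l] at the [N]-th roots of unity, divided by [N]. *)
Definition poisson_weight l N j : R :=
  let u := l * (conjc (unit_root R N)) ^+ j in
  N%:R^-1 * ((1 - normc u ^+ 2) / normc (1 - u) ^+ 2).

Lemma poisson_weight_ge0 l N j : normc l < 1 -> 0 <= poisson_weight l N j.
Proof.
move=> l1; rewrite mulr_ge0 ?invr_ge0// divr_ge0 ?sqr_ge0// subr_ge0 normcM normcX.
by rewrite normc_conj normc_unit_root expr1n mulr1 expr_le1 ?normc_ge0// ltW.
Qed.

Lemma mulJ_normc z : z * conjc z = (normc z ^+ 2)%:C.
Proof.
case: z => a b; rewrite sqr_normcE/=; apply/eqP; rewrite eq_complex/=.
by apply/andP; split; apply/eqP; ring.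
Qed.

Lemma conjc_1B z : conjc (1 - z) = 1 - conjc z.
Proof.
by case: z => a b; apply/eqP; rewrite eq_complex/= sub0r opprK add0r !eqxx.
Qed.

(** This decomposition shows the kernel as a sum of two geometric series, one in
    [u] and one in its conjugate. *)
Lemma poisson_kernelE (u : R[i]) : normc u < 1 ->
  ((1 - normc u ^+ 2) / normc (1 - u) ^+ 2)%:C =
  (1 - u)^-1 + conjc u / (1 - conjc u).
Proof.
move=> u1; have h (v : R[i]) : normc v < 1 -> 1 - v != 0.
  by apply: contraTN; rewrite subr_eq0 => /eqP <-; rewrite normc1 ltxx.
have h1 := h _ u1; have := h (conjc u); rewrite normc_conj => /(_ u1) h2.
rewrite fmorph_div/= rmorphB/= -!mulJ_normc conjc_1B.
by field; rewrite h1 h2.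
Qed.

Lemma conj_unit_root N : conjc (unit_root R N) = (unit_root R N)^-1.
Proof.
apply: (mulIf (x := unit_root R N)); first by rewrite -normc_eq0 normc_unit_root oner_eq0.
rewrite mulVf -?normc_eq0 ?normc_unit_root ?oner_eq0// mulrC mulJ_normc normc_unit_root.
by rewrite expr1n.
Qed.

(** On the [N]-th roots of unity each of the two geometric series folds into a sum
    over one period, and the orthogonality relation [sum_unity_root] retains a
    single term of either sum. *)
Lemma poisson_momentE l N n : normc l < 1 -> (n < N)%N ->
  moment N (poisson_weight l N) n =
  l ^+ n / (1 - l ^+ N) + conjc l ^+ (N - n) / (1 - conjc l ^+ N).
Proof.
move=> l1 nN; have N0 : (0 < N)%N by exact: leq_ltn_trans nN.
have NC : N%:R != 0 :> R[i] by rewrite pnatr_eq0 -lt0n.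
have prim := unit_root_prim R N0; set om := unit_root R N in prim *.
have om0 : om != 0 by rewrite -normc_eq0 normc_unit_root oner_eq0.
have omN : om ^+ N = 1 by exact: prim_expr_order.
have lN (v : R[i]) : normc v < 1 -> v ^+ N != 1.
  move=> v1; apply/eqP => /(congr1 (@normc R)); rewrite normcX normc1 => vN.
  by have := @exprn_ilt1 _ N _ (normc_ge0 v) v1; rewrite -lt0n N0 vN ltxx.
have lJ1 : normc (conjc l) < 1 by rewrite normc_conj.
have omj (j : nat) : om ^+ j ^+ N = 1 by rewrite exprAC omN expr1n.
(* The exponent [N - m] stands for [- m], which is legitimate on the roots of
   unity. *)
transitivity (N%:R^-1 * (\sum_(j < N)
   ((\sum_(m < N) l ^+ m * om ^+ (j * (N - m + n))) / (1 - l ^+ N) +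
    (\sum_(m < N) conjc l ^+ m.+1 * om ^+ (j * (m.+1 + n))) /
      (1 - conjc l ^+ N)))).
  rewrite mulr_sumr; apply: eq_bigr => j _; rewrite /poisson_weight.
  rewrite conj_unit_root -/om exprVn rmorphM/= fmorphV/= rmorph_nat -mulrA; congr (_ * _).
  set u := l * _; have u1 : normc u < 1.
    by rewrite /u normcM normcV normcX normc_unit_root expr1n invr1 mulr1.
  rewrite poisson_kernelE// mulrDl; congr (_ + _).
    have uN : u ^+ N = l ^+ N by rewrite exprMn exprVn omj invr1 mulr1.
    rewrite (@geometric_unity N) uN ?lN// mulrAC; congr (_ / _).
    rewrite mulr_suml; apply: eq_bigr => m _; rewrite exprMn -mulrA; congr (_ * _).
    rewrite mulnDr exprD exprM; congr (_ * _); last by rewrite exprM.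
    rewrite exprVn; apply: (mulfI (x := om ^+ j ^+ m)); first by rewrite !expf_neq0.
    by rewrite divff ?expf_neq0// -exprD subnKC ?omj// ltnW.
  have uJ : conjc u = conjc l * om ^+ j.
    rewrite /u rmorphM fmorphV rmorphXn.
    by rewrite -[X in _ / X ^+ j]/(conjc (unit_root R N)) conj_unit_root exprVn invrK.
  have uN : conjc u ^+ N = conjc l ^+ N by rewrite uJ exprMn omj mulr1.
  rewrite [conjc u / _](_ : _ = conjc u * (1 - conjc u)^-1)//.
  rewrite (@geometric_unity N) uN ?lN// mulrA mulrAC; congr (_ / _).
  rewrite mulr_sumr mulr_suml; apply: eq_bigr => m _.
  by rewrite -exprS uJ exprMn -mulrA mulnDr exprD !exprM.
clearbody om; rewrite big_split/= -!mulr_suml mulrDr !mulrA; congr (_ / _ + _ / _).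
  rewrite exchange_big/= (bigD1 (Ordinal nN))//= [X in _ + X]big1 ?addr0.
    rewrite -mulr_sumr subnK ?(ltnW nN)//.
    rewrite (eq_bigr (fun=> 1)) ?sumr_const ?card_ord; last first.
      by move=> j _; rewrite mulnC exprM omN expr1n.
    by rewrite mulrCA mulVf// mulr1.
  move=> m mn; rewrite -mulr_sumr.
  under eq_bigr do rewrite mulnC exprM.
  have hz : om ^+ (N - m + n) ^+ N = 1 by rewrite exprAC omN expr1n.
  rewrite (sum_unity_root hz) ifF; first exact: mulr0.
  apply/negbTE; apply: contra mn; rewrite -(prim_order_dvd prim) -val_eqE/= => dv.
  have : om ^+ (N - m + n) * om ^+ m == om ^+ m.
    by move: dv; rewrite (prim_order_dvd prim) => /eqP->; rewrite mul1r.
  rewrite -exprD addnAC subnK ?(ltnW (ltn_ord m))// exprD omN mul1r.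
  by rewrite (eq_prim_root_expr prim) !modn_small// eq_sym.
have NnN : (N - n.+1 < N)%N by rewrite ltn_subrL.
rewrite exchange_big/= (bigD1 (Ordinal NnN))//= [X in _ + X]big1 ?addr0.
  rewrite -mulr_sumr -subSn// subSS subnK ?(ltnW nN)//.
  rewrite (eq_bigr (fun=> 1)) ?sumr_const ?card_ord; last first.
    by move=> j _; rewrite mulnC exprM omN expr1n.
  by rewrite mulrCA mulVf// mulr1.
move=> m mn; rewrite -mulr_sumr.
under eq_bigr do rewrite mulnC exprM.
have hz : om ^+ (m.+1 + n) ^+ N = 1 by rewrite exprAC omN expr1n.
rewrite (sum_unity_root hz) ifF; first exact: mulr0.
apply/negbTE; apply: contra mn; rewrite -(prim_order_dvd prim) -val_eqE/= => /dvdnP[k hk].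
have mN := ltn_ord m.
have k1 : k = 1%N.
  have k2 : (k * N < 2 * N)%N by rewrite -hk; lia.
  have k0 : (0 * N < k * N)%N by rewrite -hk; lia.
  by move: k0 k2; rewrite !ltn_mul2r => /andP[_ k0] /andP[_ k2]; lia.
by apply/eqP; rewrite k1 in hk; lia.
Qed.

End DiscreteMoments.

(** * Approximation by discrete moments *)

Section Approximable.
Variable R : realType.
Implicit Types (x y : nat -> R[i]) (w : nat -> R) (l z : R[i]).

Lemma near_forall_leq (T : Type) (F : set_system T) (FF : Filter F)
    (P : nat -> T -> Prop) m :
  (forall n, \forall N \near F, P n N) ->
  \forall N \near F, forall n, (n <= m)%N -> P n N.
Proof.
move=> H; elim: m => [|m IH].
  by apply: filterS (H 0%N) => N h n; rewrite leqn0 => /eqP->.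
apply: filterS2 IH (H m.+1) => N h1 h2 n.
by rewrite leq_eqVlt => /predU1P[->//|]; rewrite ltnS; exact: h1.
Qed.

(** Both the second term of [poisson_momentE] and the correction to the first one
    are bounded by a constant multiple of [normc l ^+ (N - n)]. *)
Lemma poisson_moment_cvg l n (e : R) : normc l < 1 -> 0 < e ->
  \forall N \near \oo, normc (phi l n - moment N (poisson_weight l N) n) < e.
Proof.
move=> l1 e0; have r0 := normc_ge0 l; set r := normc l in l1 r0.
have r10 : 0 < 1 - r by rewrite subr_gt0.
have e'0 : 0 < e * (1 - r) / 2 by rewrite divr_gt0// mulr_gt0.
have : (GRing.exp r : nat -> R) @ \oo --> 0 by apply: cvg_expr; rewrite ger0_norm.
move=> /cvgrPdist_lt/(_ _ e'0)[M _ hM].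
near=> N.
have nN : (n < N)%N by near: N; exists n.+1.
have MN : (M <= N - n)%N by near: N; exists (M + n)%N => // k /= h; lia.
have N0 : (0 < N)%N by exact: leq_ltn_trans nN.
have rNr : r ^+ N <= r.
  by rewrite -{2}[r]expr1; apply: ler_wiXn2l => //; exact: ltW.
have lN (v : R[i]) : normc v = r -> 1 - r <= normc (1 - v ^+ N).
  move=> vr; have := le_normcB 1 (v ^+ N).
  by rewrite normcX vr normc1; apply: le_trans; rewrite lerD2l lerN2.
have lN0 (v : R[i]) : normc v = r -> 1 - v ^+ N != 0.
  by move=> /lN h; rewrite -normc_eq0 gt_eqF// (lt_le_trans r10).
have l0 := lN0 l erefl.
rewrite poisson_momentE// /phi.
have -> : l ^+ n - (l ^+ n / (1 - l ^+ N) + l^* ^+ (N - n) / (1 - l^* ^+ N)) =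
   - (l ^+ (n + N) / (1 - l ^+ N)) - l^* ^+ (N - n) / (1 - l^* ^+ N).
  rewrite opprD addrA; congr (_ - _); rewrite exprD; field.
  by rewrite l0.
rewrite -opprD normcN (le_lt_trans (le_normcD _ _))//.
have h1 : normc (l ^+ (n + N) / (1 - l ^+ N)) <= r ^+ (N - n) / (1 - r).
  rewrite normcM normcV normcX; apply: ler_pM => //.
  - by rewrite exprn_ge0.
  - by rewrite invr_ge0 normc_ge0.
  - by apply: ler_wiXn2l => //; [exact: ltW | lia].
  - by rewrite lef_pV2 ?posrE// ?(lt_le_trans r10) ?lN.
have h2 : normc (l^* ^+ (N - n) / (1 - l^* ^+ N)) <= r ^+ (N - n) / (1 - r).
  rewrite normcM normcV normcX normc_conj; apply: ler_pM => //.
  - by rewrite exprn_ge0.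
  - by rewrite invr_ge0 normc_ge0.
  - by rewrite lef_pV2 ?posrE// ?(lt_le_trans r10) ?lN ?normc_conj.
have := hM _ MN; rewrite sub0r normrN ger0_norm ?exprn_ge0// => h3.
have : r ^+ (N - n) / (1 - r) < e / 2.
  by rewrite ltr_pdivrMr// mulrAC.
by move: h1 h2; lra.
Unshelve. all: by end_near.
Qed.

Lemma approximable_phi l : normc l < 1 -> approximable (phi l).
Proof.
move=> l1 m e e0.
have h : \forall N \near \oo, forall n, (n <= m)%N ->
    normc (phi l n - moment N (poisson_weight l N) n) < e.
  by apply: near_forall_leq => n; exact: poisson_moment_cvg.
apply: filterS h => N hN; exists (poisson_weight l N) => // j.
exact: poisson_weight_ge0.
Qed.

(** Weights at a common [N] may be combined convexly. *)
Lemma approximable_conv (s : R) x y : 0 <= s <= 1 ->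
  approximable x -> approximable y ->
  approximable (fun n => s%:C * x n + (1 - s)%:C * y n).
Proof.
move=> /andP[s0 s1] hx hy m e e0.
apply: filterS2 (hx m e e0) (hy m e e0) => N [w w0 hw] [v v0 hv].
have s1' : 0 <= 1 - s by rewrite subr_ge0.
exists (fun j => s * w j + (1 - s) * v j) => [j|n nm].
  by rewrite addr_ge0// mulr_ge0.
have -> : moment N (fun j => s * w j + (1 - s) * v j) n =
   s%:C * moment N w n + (1 - s)%:C * moment N v n.
  rewrite !mulr_sumr -big_split/=; apply: eq_bigr => j _.
  by rewrite rmorphD !rmorphM/= mulrDl !mulrA.
rewrite opprD addrACA -!mulrBr (le_lt_trans (le_normcD _ _))//.
rewrite !normcM !normc_real !ger0_norm//.
have h1 := ler_wpM2l s0 (ltW (hw n nm)); have h2 := ler_wpM2l s1' (ltW (hv n nm)).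
have [s00|] := eqVneq s 0; first by rewrite s00 mul0r subr0 mul1r add0r hv.
move=> sn0; have sp : 0 < s by rewrite lt_def sn0.
by have := hw n nm; rewrite -(ltr_pM2l sp); lra.
Qed.

Lemma S0_approximable y : @S0 R y -> approximable y.
Proof.
apply: (@S0_ind R (@approximable R)); [exact: approximable_phi|exact: approximable_conv|].
move=> v hv m e e0; have e20 : 0 < e / 2 by rewrite divr_gt0.
have [u hu uv] := hv _ e20; apply: filterS (hu m _ e20) => N [w w0 hw].
exists w => // n nm; rewrite -(subrKA (u n)) (le_lt_trans (le_normcD _ _))//.
by rewrite (splitr e) ltrD// hw.
Qed.

End Approximable.

(** * A Helly selection principle *)

Section Selection.
Variable R : realType.
Implicit Types (y : nat -> R[i]) (w : nat -> R) (z : R[i]) (s t : R).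

Local Notation mesh := (@mesh R).

Lemma cisX_lipschitz s t n :
  normc (cis s ^+ n - cis t ^+ n) <= 2 * n%:R * `|s - t|.
Proof.
have c1 u : normc (cis u : R[i]) <= 1 by rewrite normc_cis.
rewrite (le_trans (normc_subX n (c1 s) (c1 t)))// (mulrC 2) -mulrA.
by rewrite ler_wpM2l// cis_lipschitz.
Qed.

(** Used with [I i] the integral over the part of the circle before the [i]-th
    point of subdivision, for discrete measures and then for the limit. *)
Lemma telescope_le (I g : nat -> R[i]) (F : nat -> R) (e : R) M :
  I 0%N = 0 ->
  (forall i, (i < M)%N -> normc (I i.+1 - I i - g i * (F i.+1 - F i)%:C) <=
    e * (F i.+1 - F i)) ->
  normc (I M - \sum_(i < M) g i * (F i.+1 - F i)%:C) <= e * (F M - F 0%N).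
Proof.
move=> I0; elim: M => [|M IH] h; first by rewrite big_ord0 I0 !subrr normc0 mulr0.
rewrite big_ord_recr/=.
have -> : I M.+1 - (\sum_(i < M) g i * (F i.+1 - F i)%:C + g M * (F M.+1 - F M)%:C) =
  (I M.+1 - I M - g M * (F M.+1 - F M)%:C) + (I M - \sum_(i < M) g i * (F i.+1 - F i)%:C).
  by ring.
rewrite (le_trans (le_normcD _ _))//.
have := h M (leqnn _); have := IH (fun i iM => h i (ltnW iM)); lra.
Qed.

(** The strict inequality gives value 0 at the angle 0, and total mass at [2 pi],
    since all points of the mesh other than the last one are smaller. *)
Definition distribution_fun N w t : R := \sum_(j < N | mesh N j < t) w j.

Lemma distribution_fun_le N w s t : (forall j, 0 <= w j) -> s <= t ->
  distribution_fun N w s <= distribution_fun N w t.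
Proof.
move=> w0 st; rewrite /distribution_fun [leLHS]big_mkcond [leRHS]big_mkcond/=.
apply: ler_sum => j _; case: ifPn => h; first by rewrite (lt_le_trans h st).
by case: ifP.
Qed.

Lemma distribution_fun0 N w : distribution_fun N w 0 = 0.
Proof. by rewrite /distribution_fun big1// => j; rewrite -(@mesh0 R N) ltNge mesh_le. Qed.

Lemma mesh_lt_2pi N (j : 'I_N) : mesh N j < 2 * pi.
Proof.
have N0 : (0 < N)%N by apply: leq_ltn_trans (ltn_ord j).
rewrite -[ltRHS](@mesh_last R N N0) ltr_pM2r ?invr_gt0 ?ltr0n//.
by rewrite ltr_pM2l ?ltr_nat// mulr_gt0// pi_gt0.
Qed.

Lemma distribution_fun_total N w :
  (distribution_fun N w (2 * pi))%:C = moment N w 0.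
Proof.
rewrite /distribution_fun (eq_bigl predT) => [|j]; last exact: mesh_lt_2pi.
by rewrite rmorph_sum; apply: eq_bigr => j _; rewrite expr0 mulr1.
Qed.

Definition riemann_sum M n (F : R -> R) : R[i] :=
  \sum_(i < M) cis (mesh M i) ^+ n * (F (mesh M i.+1) - F (mesh M i))%:C.

Lemma moment_riemann N w M n : (forall j, 0 <= w j) -> (0 < M)%N ->
  normc (moment N w n - riemann_sum M n (distribution_fun N w)) <=
   4 * pi * n%:R / M%:R * distribution_fun N w (2 * pi).
Proof.
move=> w0 M0; pose I i : R[i] :=
  \sum_(j < N | mesh N j < mesh M i) (w j)%:C * cis (mesh N j) ^+ n.
have := @telescope_le I (fun i => cis (mesh M i) ^+ n)
  (fun i => distribution_fun N w (mesh M i)) (4 * pi * n%:R / M%:R) M.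
rewrite /= mesh_last// mesh0 distribution_fun0 subr0.
have -> : I M = moment N w n.
  rewrite /I mesh_last// (eq_bigl predT) => [|j]; last exact: mesh_lt_2pi.
  by apply: eq_bigr => j _; rewrite unit_rootX.
apply; first by rewrite /I mesh0 big1// => j; rewrite -(@mesh0 R N) ltNge mesh_le.
move=> i iM; have st : mesh M i <= mesh M i.+1 by exact: mesh_le.
have split (V : nmodType) (G : 'I_N -> V) : \sum_(j < N | mesh N j < mesh M i.+1) G j =
   \sum_(j < N | mesh N j < mesh M i) G j +
   \sum_(j < N | mesh M i <= mesh N j < mesh M i.+1) G j.
  rewrite (bigID (fun j : 'I_N => mesh N j < mesh M i))/=; congr (_ + _).
    apply: eq_bigl => j; case: (ltP (mesh N j) (mesh M i)) => h; rewrite ?andbF//.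
    by rewrite (lt_le_trans h st).
  by apply: eq_bigl => j; rewrite -leNgt andbC.
have addKl (V : zmodType) (a c : V) : a + c - a = c by rewrite addrAC subrr add0r.
rewrite /I /distribution_fun !split !addKl.
rewrite rmorph_sum mulr_sumr -sumrB (le_trans (le_normc_sum _ _ _))// mulr_sumr.
apply: ler_sum => j /andP[h1 h2]; rewrite [(w j)%:C * _]mulrC -mulrBl normcM normc_real.
rewrite (ger0_norm (w0 j)) ler_wpM2r// (le_trans (cisX_lipschitz _ _ _))//.
rewrite ger0_norm ?subr_ge0//.
have : mesh N j - mesh M i <= 2 * pi / M%:R by rewrite -(@mesh_step R M i) lerD2r ltW.
by move=> /(ler_wpM2l (ler0n R n)); lra.
Qed.

(** Either a set or its complement has its preimage in the ultrafilter. *)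
Lemma ultra_fmap (T V : Type) (f : T -> V) (U : set_system T) :
  UltraFilter U -> UltraFilter (f @ U).
Proof.
move=> UU; split; first exact: fmap_proper_filter.
move=> G GG fUG; apply/seteqP; split=> // A GA.
have [//|UA] := in_ultra_setVsetC (f @^-1` A) UU.
have GCA : G (~` A) by exact: fUG.
by have /filter_not_empty : G set0 by rewrite -(setICr A); exact: filterI.
Qed.

(** The limit of the distribution functions is taken along an ultrafilter, so that
    it exists at every point at once.  A Riemann sum involves finitely many
    points, so for any given accuracy a single index serves all of them; the
    bound of [moment_riemann] is uniform in the index. *)
Lemma helly_selection y : approximable y -> y 0%N = 1 ->
  exists F : R -> R, [/\ {homo F : s t / s <= t}, F 0 = 0, F (2 * pi) = 1 &
    forall M n, (0 < M)%N ->
      normc (y n - riemann_sum M n F) <= 8 * pi * n%:R / M%:R].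
Proof.
move=> ay y0.
have /choice[Nw hNw] (k : nat) : exists Nw : nat * (nat -> R), (forall j, 0 <= Nw.2 j) /\
   forall n, (n <= k)%N -> normc (y n - moment Nw.1 Nw.2 n) < k.+1%:R^-1.
  have k0 : 0 < k.+1%:R^-1 :> R by rewrite invr_gt0.
  have [N _ /(_ N (leqnn N)) [w w0 hw]] := ay k _ k0.
  by exists (N, w).
pose Fk k := distribution_fun (Nw k).1 (Nw k).2.
have Fk_le k : {homo Fk k : s t / s <= t}.
  by move=> s t; apply: distribution_fun_le; exact: (hNw k).1.
have Fk0 k : Fk k 0 = 0 by exact: distribution_fun0.
have Fk1 k : `|1 - Fk k (2 * pi)| < k.+1%:R^-1.
  have := (hNw k).2 0%N (leq0n _); rewrite y0 -distribution_fun_total.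
  by rewrite -[1 in X in X -> _](rmorph1 (real_complex R)) -rmorphB normc_real.
have Fk2 k : Fk k (2 * pi) <= 2.
  have := Fk1 k; have : k.+1%:R^-1 <= 1 :> R by rewrite invf_le1// ler1n.
  rewrite ltr_norml => h1 /andP[h2 _]; move: (k.+1%:R^-1) h1 h2 => q; lra.
have [U [UU ooU]] := ultraFilterLemma (eventually_filter).
have U_oo (P : nat -> Prop) : (\forall k \near \oo, P k) -> \forall k \near U, P k.
  exact: ooU.
(* Clamping the argument to the interval from 0 to [2 pi] makes the values
   bounded, whence a limit at every real number. *)
pose clamp t : R := Num.max 0 (Num.min (2 * pi) t).
have pi0 : 0 <= 2 * pi :> R by rewrite mulr_ge0// pi_ge0.
have clamp_le : {homo clamp : s t / s <= t}.
  move=> s t st; rewrite /clamp ge_max !le_max lexx/=; apply/orP; right.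
  by rewrite le_min !ge_min lexx st orbT.
have clamp0 : clamp 0 = 0 by rewrite /clamp min_r// maxxx.
have clamp1 : clamp (2 * pi) = 2 * pi by rewrite /clamp minxx max_r.
have /choice[F FE] (t : R) : exists l : R, (fun k => Fk k (clamp t)) @ U --> l.
  have := @segment_compact R 0 2; rewrite compact_ultra.
  move=> /(_ ((fun k => Fk k (clamp t)) @ U)); case.
  - exact: ultra_fmap.
  - apply: (@filterS _ U _ setT); last exact: filterT.
    move=> k _ /=; rewrite in_itv/=; rewrite -{1}(Fk0 k) Fk_le ?le_max ?lexx//=.
    by rewrite (le_trans _ (Fk2 k))// Fk_le// ge_max pi0 ge_min lexx.
  by move=> l [_ hl]; exists l.
have F_lim t l : (fun k => Fk k (clamp t)) @ U --> l -> F t = l.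
  exact: (cvg_unique (@Rhausdorff R) (FE t)).
exists F; split.
- move=> s t st; apply: (ler_cvg_to (FE s) (FE t)); apply: nearW => k.
  exact/Fk_le/clamp_le.
- by apply: F_lim; rewrite clamp0; under eq_fun do rewrite Fk0; exact: cvg_cst.
- apply: F_lim; rewrite clamp1; apply/cvgrPdist_lt => e e0; apply: U_oo.
  near=> k; apply: (lt_trans (Fk1 k)); near: k.
  exact: near_infty_natSinv_lt (PosNum e0).
move=> M n M0; apply/ler_addgt0Pr => e e0.
have MR : 0 < M%:R :> R by rewrite ltr0n.
have e20 : 0 < e / 2 by rewrite divr_gt0.
have e40 : 0 < e / 4 / M%:R by rewrite !divr_gt0.
have hU : \forall k \near U, forall i, (i <= M)%N ->
    `|F (mesh M i) - Fk k (clamp (mesh M i))| < e / 4 / M%:R.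
  apply: near_forall_leq => i; move/cvgrPdist_lt: (FE (mesh M i)); exact.
have hoo : \forall k \near U, (n <= k)%N /\ k.+1%:R^-1 < e / 2.
  apply: U_oo; near=> k; split; near: k; first by exists n.
  exact: near_infty_natSinv_lt (PosNum e20).
have [k [hk1 [hk2 hk3]]] := @filter_ex _ U _ _ (filterI hU hoo).
have clampM i : (i <= M)%N -> clamp (mesh M i) = mesh M i.
  move=> iM; rewrite /clamp min_r ?max_r//; first by rewrite -(@mesh0 R M) mesh_le.
  by rewrite -(@mesh_last R M M0) mesh_le.
have h1 : normc (riemann_sum M n (Fk k) - riemann_sum M n F) <= e / 2.
  rewrite -sumrB (le_trans (le_normc_sum _ _ _))//.
  rewrite (_ : e / 2 = \sum_(i < M) (e / 2 / M%:R)); last first.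
    by rewrite sumr_const card_ord -[RHS]mulr_natr divfK// gt_eqF.
  apply: ler_sum => i _; rewrite -mulrBr -rmorphB normcM normcX normc_cis expr1n mul1r.
  rewrite normc_real; have := hk1 i (ltnW (ltn_ord i)); have := hk1 i.+1 (ltn_ord i).
  rewrite !clampM ?(ltnW (ltn_ord i))//.
  by rewrite !ltr_norml ler_norml => /andP[? ?] /andP[? ?]; apply/andP; split; lra.
have h2 := (hNw k).2 n hk2.
have h3 := moment_riemann (Nw k).1 n (hNw k).1 M0.
have c0 : 0 <= 4 * pi * n%:R / M%:R :> R.
  by rewrite divr_ge0// !mulr_ge0// pi_ge0.
have h4 := ler_wpM2l c0 (Fk2 k).
have -> : y n - riemann_sum M n F = (y n - moment (Nw k).1 (Nw k).2 n) +
   ((moment (Nw k).1 (Nw k).2 n - riemann_sum M n (Fk k)) +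
   (riemann_sum M n (Fk k) - riemann_sum M n F)) by rewrite !subrKA.
rewrite (le_trans (le_normcD _ _))//.
have := le_normcD (moment (Nw k).1 (Nw k).2 n - riemann_sum M n (Fk k))
   (riemann_sum M n (Fk k) - riemann_sum M n F).
have {}h2 := lt_trans h2 hk3; have {}h3 := le_trans h3 h4.
by move: h1 h2 h3; move: (normc _) (normc _) (normc _) (normc _) => *; lra.
Unshelve. all: by end_near.
Qed.

End Selection.

(** * Borel functions on the circle *)

Section CircleBorel.
Variable R : realType.

Lemma cis_continuous : continuous (@cis R).
Proof.
move=> t; apply/cvg_normcP => e e0.
have e20 : 0 < e / 2 by rewrite divr_gt0.
near=> s; have : `|t - s| < e / 2.
  by near: s; apply: cvgr_dist_lt => //; exact: cvg_id.
by move=> h; apply: (le_lt_trans (cis_lipschitz _ _)); lra.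
Unshelve. all: by end_near.
Qed.

Definition circle_cis (t : R) : circle R :=
  exist _ (cis t) (mem_set (normc_cis t)).

Lemma circle_cis_continuous : continuous circle_cis.
Proof. by apply: continuous_comp_initial => t; exact: cis_continuous. Qed.

Lemma set_val_circle_continuous : continuous (fun t : circle R => set_val t).
Proof. exact: initial_continuous. Qed.

Lemma open_measurable_circle (U : set (circle R)) : open U ->
  measurable (U : set (borel_circle R)).
Proof. by move=> oU; apply: sub_sigma_algebra. Qed.

Lemma continuous_measurable_circle (f : circle R -> R) : continuous f ->
  measurable_fun setT (f : borel_circle R -> R).
Proof.
move=> cf; apply: (measurability _ (measurable_realfun.RGenOInfty.measurableE R)).
move=> _ [_ [a ->] <-]; rewrite setTI; apply: open_measurable_circle.
by apply: open_comp => // t _; exact: cf.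
Qed.

Lemma measurable_to_circle d (T : measurableType d) (psi : T -> circle R) :
  (forall U, open U -> measurable (psi @^-1` U)) ->
  measurable_fun setT (psi : T -> borel_circle R).
Proof.
move=> h; apply: (@measurability _ _ T (borel_circle R) setT psi
  (@open (circle R))) => //.
by move=> _ [U oU <-]; rewrite setTI; exact: h.
Qed.

Lemma Re_continuous : continuous (fun z : R[i] => complex.Re z).
Proof.
move=> z; apply/(@cvgrPdist_lt _ _ _ _ (nbhs_filter z)) => e e0.
have := proj1 (@cvg_normcP R _ (nbhs z) (nbhs_filter z) id z) cvg_id e e0.
apply: filterS => w; apply: le_lt_trans; have := le_Re_normc (z - w).
by case: z w => a b [c d].
Qed.

Lemma Im_continuous : continuous (fun z : R[i] => complex.Im z).
Proof.
move=> z; apply/(@cvgrPdist_lt _ _ _ _ (nbhs_filter z)) => e e0.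
have := proj1 (@cvg_normcP R _ (nbhs z) (nbhs_filter z) id z) cvg_id e e0.
apply: filterS => w; apply: le_lt_trans; have := le_Im_normc (z - w).
by case: z w => a b [c d].
Qed.

Lemma circle_exp_continuous n : continuous (fun t : circle R => set_val t ^+ n : R[i]).
Proof.
move=> t; elim: n => [|n IH].
  rewrite (_ : (fun s : circle R => set_val s ^+ 0 : R[i]) = fun=> 1).
    exact: cst_continuous.
  by apply/funext => s; rewrite expr0.
rewrite (_ : (fun s : circle R => set_val s ^+ n.+1 : R[i]) =
  fun s => set_val s * set_val s ^+ n); last by apply/funext => s; rewrite exprS.
exact: (cvgM (@set_val_circle_continuous t) IH).
Qed.

Lemma Re_circle_exp_continuous n :
  continuous (fun t : circle R => complex.Re (set_val t ^+ n)).
Proof.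
move=> t; apply: (@continuous_comp _ _ _ (fun t : circle R => set_val t ^+ n)
  (fun z : R[i] => complex.Re z)).
  exact: circle_exp_continuous.
exact: Re_continuous.
Qed.

Lemma Im_circle_exp_continuous n :
  continuous (fun t : circle R => complex.Im (set_val t ^+ n)).
Proof.
move=> t; apply: (@continuous_comp _ _ _ (fun t : circle R => set_val t ^+ n)
  (fun z : R[i] => complex.Im z)).
  exact: circle_exp_continuous.
exact: Im_continuous.
Qed.

End CircleBorel.

(** * Integrals of functions close to a step function *)

Section StepIntegral.
Context d (T : measurableType d) (R : realType) (mu : probability T R).
Local Notation "\intr_ A h" := (Rintegral mu A h) (at level 10, A at level 8).

Lemma bounded_integrable (h : T -> R) (A : set T) (c : R) :
  measurable A -> measurable_fun setT h -> (forall u, `|h u| <= c) ->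
  mu.-integrable A (EFin \o h).
Proof.
move=> mA mh hc; apply: measurable_bounded_integrable => //.
- by apply: le_lt_trans (probability_le1 mu mA) _; rewrite ltry.
- exact: measurable_funTS.
- by exists c; split=> [|x cx u _ /=]; rewrite ?num_real// (le_trans (hc u))// ltW.
Qed.

Lemma step_integral (h : T -> R) (A : set T) (c c' e : R) :
  measurable A -> measurable_fun setT h -> (forall u, `|h u| <= c') ->
  (forall u, A u -> `|h u - c| <= e) ->
  `|Rintegral mu A h - c * fine (mu A)| <= e * fine (mu A).
Proof.
move=> mA mh hc' hc.
have ih := bounded_integrable mA mh hc'.
have ic k : mu.-integrable A (EFin \o (cst k : T -> R)).
  by apply: (@bounded_integrable _ _ `|k|) => // u.
rewrite -(Rintegral_cst mu mA c) -RintegralB//; last exact: (ic c).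
have ihc : mu.-integrable A (EFin \o (fun u => h u - c)).
  apply: (@bounded_integrable _ _ (c' + `|c|)) => //.
    by apply: measurable_realfun.measurable_funB => //; exact: measurable_cst.
  by move=> u; rewrite (le_trans (ler_normB _ _))// lerD2r.
rewrite (le_trans (le_normr_Rintegral mA ihc))// -(Rintegral_cst mu mA e).
apply: le_Rintegral => //; last exact: (ic e).
apply: (@bounded_integrable _ _ (c' + `|c|)) => //.
  apply: measurableT_comp => //.
  by apply: measurable_realfun.measurable_funB => //; exact: measurable_cst.
by move=> u; rewrite normr_id (le_trans (ler_normB _ _))// lerD2r.
Qed.

Lemma Rintegral_split (h : T -> R) (A B : set T) (c' : R) :
  measurable A -> measurable B -> [disjoint A & B] ->
  measurable_fun setT h -> (forall u, `|h u| <= c') ->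
  Rintegral mu (A `|` B) h = Rintegral mu A h + Rintegral mu B h.
Proof.
move=> mA mB AB mh hc'; apply: Rintegral_setU => //.
by apply: bounded_integrable mh hc' => //; exact: measurableU.
Qed.

End StepIntegral.

Section Quantile.
Variable R : realType.
Variable F : R -> R.
Hypothesis F_le : {homo F : s t / s <= t}.
Hypothesis F0 : F 0 = 0.
Hypothesis F1 : F (2 * pi) = 1.

(** The generalized inverse of [F].  Truncating [u] at 0 keeps the set non-empty,
    which makes the function monotone on the whole line. *)
Definition quantile (u : R) : R :=
  sup [set t | 0 <= t <= 2 * pi /\ F t <= Num.max 0 u].

Let pi0 : 0 <= 2 * pi :> R.
Proof. by rewrite mulr_ge0// pi_ge0. Qed.

Let qset u : set R := [set t | 0 <= t <= 2 * pi /\ F t <= Num.max 0 u].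

Let qset0 u : qset u 0.
Proof. by split; rewrite ?lexx//= F0 le_max lexx. Qed.

Let qset_sup u : has_sup (qset u).
Proof.
split; first by exists 0; exact: qset0.
by exists (2 * pi) => t [/andP[]].
Qed.

Lemma quantile_le : {homo quantile : s t / s <= t}.
Proof.
move=> s t st; apply: sup_le_ub; first by exists 0; exact: (qset0 s).
move=> x [x1 x2]; apply: ub_le_sup; first exact: (qset_sup t).2.
split=> //; apply: (le_trans x2); rewrite ge_max !le_max lexx/= st orbT.
by [].
Qed.

Lemma quantile_in (s t u : R) : 0 <= s -> t <= 2 * pi ->
  F s <= u -> u < F t -> s <= quantile u <= t.
Proof.
move=> s0 t2 su ut.
have u0 : 0 <= u by apply: le_trans su; rewrite -F0 F_le.
have st : s <= t by rewrite leNgt; apply/negP => /ltW/F_le; lra.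
apply/andP; split.
  apply: ub_le_sup; first exact: (qset_sup u).2.
  by split; [rewrite s0 (le_trans st) | rewrite le_max su orbT].
apply: sup_le_ub; first by exists 0; exact: (qset0 u).
move=> x [_]; rewrite max_r// => xu.
by rewrite leNgt; apply/negP => /ltW/F_le; lra.
Qed.

Lemma quantile_measurable : measurable_fun setT quantile.
Proof. exact: measurable_realfun.nondecreasing_measurable quantile_le. Qed.

End Quantile.

(** * The moments of the quantile transform *)

Section RepresentingMeasure.
Variable R : realType.

Let m01 := @measurable_itv R `[0%R, 1%R[.
(** A measure on the whole line, so that the quantile transform keeps its domain. *)
Definition uniform01 : set (measurableTypeR R) -> \bar R :=
  mrestr (@lebesgue_measure R) m01.
HB.instance Definition _ := Measure.on uniform01.

Lemma uniform01T : uniform01 setT = 1%E.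
Proof.
rewrite /uniform01 /mrestr setTI lebesgue_measure_itv/= lte01.
by rewrite oppr0 adde0.
Qed.
HB.instance Definition _ := Measure_isProbability.Build _ _ _ uniform01 uniform01T.

Lemma uniform01_itv (s t : R) : 0 <= s -> s <= t -> t <= 1 ->
  uniform01 `[s, t[%classic = (t - s)%:E.
Proof.
move=> s0 st t1; rewrite /uniform01 /mrestr setIidl.
  rewrite lebesgue_measure_itv/= lte_fin; case: ltP => // ts.
  by rewrite (_ : t = s) ?subrr//; apply/eqP; rewrite eq_le ts.
move=> u /=; rewrite !in_itv/= => /andP[h1 h2].
by rewrite (le_trans s0 h1) (lt_le_trans h2 t1).
Qed.

Lemma uniform01C : uniform01 (~` `[0, 1[%classic) = 0%E.
Proof. by rewrite /uniform01 /mrestr setICl measure0. Qed.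

(** Where [u] runs from [F (mesh M i)] to [F (mesh M i.+1)], an interval whose
    length is the weight of the [i]-th term of the Riemann sum, the quantile
    stays in the [i]-th cell, where the integrand is almost constant. *)
Lemma quantile_moment (y : nat -> R[i]) (F : R -> R) n :
  {homo F : s t / s <= t} -> F 0 = 0 -> F (2 * pi) = 1 ->
  (forall M, (0 < M)%N ->
      normc (y n - riemann_sum M n F) <= 8 * pi * n%:R / M%:R) ->
  y n = Rintegral uniform01 setT (fun u => complex.Re (cis (quantile F u) ^+ n))
     +i* Rintegral uniform01 setT (fun u => complex.Im (cis (quantile F u) ^+ n)).
Proof.
move=> Fle F0 F1 yF.
pose hr u := complex.Re (cis (quantile F u) ^+ n).
pose hi u := complex.Im (cis (quantile F u) ^+ n).
rewrite -/hr -/hi.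
have mq := quantile_measurable F0.
have hr1 u : `|hr u| <= 1.
  by rewrite (le_trans (le_Re_normc _))// normcX normc_cis expr1n.
have hi1 u : `|hi u| <= 1.
  by rewrite (le_trans (le_Im_normc _))// normcX normc_cis expr1n.
have mhr : measurable_fun setT hr.
  apply: (measurableT_comp _ mq (f := fun t : R => complex.Re (cis t ^+ n))).
  apply: measurable_realfun.continuous_measurable_fun => t.
  rewrite (_ : (fun t : R => complex.Re (cis t ^+ n)) =
    fun t => cos (n%:R * t)); last first.
    by apply/funext => s; rewrite cisX.
  apply: continuous_comp; last exact: continuous_cos.
  by apply: cvgM; [exact: cvg_cst|exact: cvg_id].
have mhi : measurable_fun setT hi.
  apply: (measurableT_comp _ mq (f := fun t : R => complex.Im (cis t ^+ n))).
  apply: measurable_realfun.continuous_measurable_fun => t.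
  rewrite (_ : (fun t : R => complex.Im (cis t ^+ n)) =
    fun t => sin (n%:R * t)); last first.
    by apply/funext => s; rewrite cisX.
  apply: continuous_comp; last exact: continuous_sin.
  by apply: cvgM; [exact: cvg_cst|exact: cvg_id].
have ITE (h : R -> R) : measurable_fun setT h -> (forall u, `|h u| <= 1) ->
    Rintegral uniform01 setT h = Rintegral uniform01 `[0, 1[%classic h.
  move=> mh h1; rewrite -(setUv `[0%R, 1%R[%classic).
  rewrite (@Rintegral_split _ _ _ uniform01 _ _ _ _ _ _ _ mh h1)//; last 2 first.
  - exact: measurableC.
  - exact/disj_setPCl.
  suff : `|Rintegral uniform01 (~` `[0, 1[%classic) h| <= 0.
    by rewrite normr_le0 => /eqP->; rewrite addr0.
  have := @step_integral _ _ _ uniform01 h (~` `[0, 1[%classic) 0 1 1.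
  rewrite /= uniform01C /= !mulr0 subr0; apply => //.
  - exact: measurableC.
  - by move=> u _; rewrite subr0.
rewrite !ITE//.
set J : R[i] := _ +i* _.
have JM M : (0 < M)%N -> normc (J - riemann_sum M n F) <= 8 * pi * n%:R / M%:R.
  move=> M0.
  pose I i : R[i] := Rintegral uniform01 `[0, F (mesh M i)[%classic hr +i*
    Rintegral uniform01 `[0, F (mesh M i)[%classic hi.
  have := @telescope_le R I (fun i => cis (mesh M i) ^+ n) (fun i => F (mesh M i))
    (8 * pi * n%:R / M%:R) M.
  rewrite /= mesh_last// mesh0 F0 F1 subr0 mulr1 /I mesh_last// F1; apply.
    by rewrite mesh0 F0 set_itvco0 !Rintegral_set0.
  move=> i iM.
  have st : F (mesh M i) <= F (mesh M i.+1) by apply: Fle; exact: mesh_le.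
  have x0 : 0 <= mesh M i :> R by have := @mesh_le R M 0 i (leq0n i); rewrite mesh0.
  have x1 : mesh M i.+1 <= 2 * pi :> R.
    by have := @mesh_le R M i.+1 M iM; rewrite mesh_last.
  have s0 : 0 <= F (mesh M i) by rewrite -F0 Fle.
  have t1 : F (mesh M i.+1) <= 1 by rewrite -F1 Fle.
  have E : `[0, F (mesh M i.+1)[%classic = `[0, F (mesh M i)[%classic `|`
     `[F (mesh M i), F (mesh M i.+1)[%classic.
    by rewrite -itv_bndbnd_setU// bnd_simp.
  have dj : [disjoint `[0, F (mesh M i)[%classic &
     `[F (mesh M i), F (mesh M i.+1)[%classic]%classic.
    apply/disj_setPS => u [/=]; rewrite !in_itv/= => /andP[_ h1] /andP[h2 _].
    by move: (lt_le_trans h1 h2); rewrite ltxx.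
  rewrite E !(@Rintegral_split _ _ _ uniform01 _ _ _ _ _ _ dj mhr hr1)//.
  rewrite !(@Rintegral_split _ _ _ uniform01 _ _ _ _ _ _ dj mhi hi1)//.
  have q u : `[F (mesh M i), F (mesh M i.+1)[%classic u ->
     normc (cis (quantile F u) ^+ n - cis (mesh M i) ^+ n) <= 4 * pi * n%:R / M%:R.
    rewrite /= in_itv/= => /andP[h1 h2].
    have /andP[q1 q2] := quantile_in Fle F0 x0 x1 h1 h2.
    rewrite (le_trans (cisX_lipschitz _ _ _))// ger0_norm ?subr_ge0//.
    have : quantile F u - mesh M i <= 2 * pi / M%:R by rewrite -(mesh_step R M i) lerD2r.
    by move=> /(ler_wpM2l (ler0n R n)); lra.
  have := @step_integral _ _ _ uniform01 hr `[F (mesh M i), F (mesh M i.+1)[%classic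
     (complex.Re (cis (mesh M i) ^+ n)) 1 (4 * pi * n%:R / M%:R).
  have := @step_integral _ _ _ uniform01 hi `[F (mesh M i), F (mesh M i.+1)[%classic
     (complex.Im (cis (mesh M i) ^+ n)) 1 (4 * pi * n%:R / M%:R).
  rewrite /= uniform01_itv//= => Hi Hr.
  have {}Hr := Hr (measurable_itv _) mhr hr1 _.
  have {}Hi := Hi (measurable_itv _) mhi hi1 _.
  apply: (le_trans (le_normc_ReIm _)).
  set g := cis (mesh M i) ^+ n in Hr Hi q *.
  set D := F _ - F _ in Hr Hi *.
  have qr u : `[F (mesh M i), F (mesh M i.+1)[%classic u ->
      `|hr u - complex.Re g| <= 4 * pi * n%:R / M%:R.
    by move=> /q; apply: le_trans; rewrite /hr -ReN -ReD le_Re_normc.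
  have qi u : `[F (mesh M i), F (mesh M i.+1)[%classic u ->
      `|hi u - complex.Im g| <= 4 * pi * n%:R / M%:R.
    by move=> /q; apply: le_trans; rewrite /hi -ImN -ImD le_Im_normc.
  have {}Hr := Hr qr; have {}Hi := Hi qi.
  have gD (v : R[i]) (x : R) : v * x%:C = (complex.Re v * x) +i* (complex.Im v * x).
    by case: v => a b; apply/eqP; rewrite eq_complex/= !mulr0 subr0 add0r !eqxx.
  have addKl (a c : R) : a + c - a = c by rewrite addrAC subrr add0r.
  by rewrite gD/= !addKl; lra.
apply/eqP; rewrite -subr_eq0 -normc_eq0 eq_le normc_ge0 andbT.
apply/ler_addgt0Pr => e e0; rewrite add0r.
pose c : R := 16 * pi * n%:R.
have c0 : 0 <= c by rewrite !mulr_ge0// pi_ge0.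
pose M := (Num.truncn (c / e)).+1.
have cM : c / M%:R <= e.
  by rewrite ler_pdivrMr ?ltr0n// mulrC -ler_pdivrMr// ltW// truncnS_gt.
rewrite -(subrKA (riemann_sum M n F)) (le_trans (le_normcD _ _))//.
have := yF M isT; have := JM M isT; rewrite normcB.
by move: cM; rewrite /c; lra.
Qed.

End RepresentingMeasure.

(** * Positive measures on the circle as complex measures *)

Section CircleMeasure.
Variable R : realType.

Section Law.
Variable psi : measurableTypeR R -> borel_circle R.
Hypothesis mpsi : measurable_fun setT psi.

(** The proof of measurability is an argument so that the structure of measure can
    be attached to this name. *)
Definition law & measurable_fun setT psi : set (borel_circle R) -> \bar R :=
  pushforward (@uniform01 R) psi.

Let law_measure : {measure set (borel_circle R) -> \bar R}.
Proof.
refine (pushforward (@uniform01 R) psi : {measure set _ -> \bar R}); exact: mpsi.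
Defined.

HB.instance Definition _ := Measure.copy (law mpsi) law_measure.

Let lawT : law mpsi setT = 1%E.
Proof. exact: uniform01T. Qed.

HB.instance Definition _ := Measure_isProbability.Build _ _ _ (law mpsi) lawT.
End Law.

Lemma representing_measure (y : nat -> R[i]) : @S0 R y ->
  exists nu : probability (borel_circle R) R, forall n,
    y n = Rintegral nu setT (fun t => complex.Re (set_val t ^+ n)) +i*
          Rintegral nu setT (fun t => complex.Im (set_val t ^+ n)).
Proof.
move=> Sy.
have [F [Fle F0 F1 yF]] := helly_selection (S0_approximable Sy) (S0_total_mass Sy).
pose psi (u : measurableTypeR R) : borel_circle R := circle_cis (quantile F u).
have mq := quantile_measurable F0.
have mpsi : measurable_fun setT psi.
  apply: measurable_to_circle => U oU.
  have -> : psi @^-1` U = quantile F @^-1` ((@circle_cis R) @^-1` U) by [].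
  rewrite -[X in measurable X]setTI; apply: mq => //.
  apply: measurable_realfun.open_measurable; apply: open_comp => // t _.
  exact: circle_cis_continuous.
pose nu : probability (borel_circle R) R := law mpsi.
exists nu => n.
have intE (f : circle R -> R) : continuous f -> (forall t, `|f t| <= 1) ->
    Rintegral nu setT f = Rintegral (@uniform01 R) setT (f \o psi).
  move=> cf f1; congr fine.
  have mf := continuous_measurable_circle cf.
  rewrite (@integral_pushforward _ _ _ _ R psi mpsi (@uniform01 R) setT (EFin \o f))//.
  - by apply/measurable_realfun.measurable_EFinP.
  - apply: (@bounded_integrable _ _ _ _ (f \o psi) _ 1) => //.
    + by rewrite preimage_setT; exact: measurableT.
    + exact: (measurableT_comp mf mpsi).
    + by move=> u; exact: f1.
rewrite (quantile_moment Fle F0 F1 (fun M M0 => yF M n M0)) !intE//.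
- exact: Im_circle_exp_continuous.
- move=> t; rewrite (le_trans (le_Im_normc _))// normcX.
  by rewrite (set_valP t) expr1n.
- exact: Re_circle_exp_continuous.
- move=> t; rewrite (le_trans (le_Re_normc _))// normcX.
  by rewrite (set_valP t) expr1n.
Qed.

End CircleMeasure.

Section MeasureAsCharge.
Context d (T : measurableType d) (R : realType).

(** A non-negative charge vanishes on the negative part of any Hahn decomposition,
    so the choice of the decomposition is immaterial. *)
Lemma jordan_integral_ge0 (c : {charge set T -> \bar R})
    (nu : {finite_measure set T -> \bar R}) (f : T -> R)
    (P N : set T) (PN : hahn_decomposition c P N) :
  (forall A, measurable A -> c A = nu A) ->
  Rintegral (jordan_pos PN) setT f - Rintegral (jordan_neg PN) setT f =
  Rintegral nu setT f.
Proof.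
move=> cnu; have [[mP posP] [mN negN] PN1 PN0] := PN.
have nuN A : measurable A -> nu (A `&` N) = 0%E.
  move=> mA; have mAN : measurable (A `&` N) by exact: measurableI.
  apply/eqP; rewrite eq_le measure_ge0 andbT -cnu//.
  by apply: negN => // x [].
have -> : Rintegral (jordan_neg PN) setT f = 0.
  rewrite /Rintegral (eq_measure_integral mzero) ?integral_measure_zero// => A mA _.
  rewrite -[LHS]/(jordan_neg PN A) jordan_negE cjordan_negE /crestr0 mem_set//.
  rewrite /crestr cnu; last exact: measurableI.
  by rewrite nuN// oppe0.
rewrite subr0 /Rintegral; congr fine; apply: eq_measure_integral => A mA _.
rewrite -[LHS]/(jordan_pos PN A) jordan_posE cjordan_posE /crestr0 mem_set//.
rewrite /crestr cnu; last exact: measurableI.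
rewrite -[in RHS](setIT A) -PN1 setIUr measureU;
  [|exact: measurableI|exact: measurableI|].
  by rewrite [X in (_ + X)%E](nuN _ mA) adde0.
by rewrite setIACA PN0 setI0.
Qed.

Lemma charge_integral_ge0 (c : {charge set T -> \bar R})
    (nu : {finite_measure set T -> \bar R}) (f : T -> R) :
  (forall A, measurable A -> c A = nu A) ->
  charge_integral c f = Rintegral nu setT f.
Proof. exact: jordan_integral_ge0. Qed.

End MeasureAsCharge.

Section MeasureAsComplexMeasure.
Variable R : realType.
Variable nu : probability (borel_circle R) R.

Definition complex_measure_of : complex_measure R :=
  ComplexMeasure (charge_of_finite_measure nu)
    (charge_of_finite_measure (@mzero _ (borel_circle R) R)).

Lemma fourier_complex_measure_of n : fourier complex_measure_of (- n%:Z) =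
  Rintegral nu setT (fun t => complex.Re (set_val t ^+ n)) +i*
  Rintegral nu setT (fun t => complex.Im (set_val t ^+ n)).
Proof.
have z0 (f : borel_circle R -> R) : Rintegral (@mzero _ (borel_circle R) R) setT f = 0.
  by rewrite /Rintegral integral_measure_zero.
rewrite /fourier /cintegral opprK /=.
have hnu f := @charge_integral_ge0 _ _ _ (charge_of_finite_measure nu) nu f
  (fun A _ => erefl).
have h0 f := @charge_integral_ge0 _ _ _
  (charge_of_finite_measure (@mzero _ (borel_circle R) R)) mzero f
  (fun A _ => erefl).
by rewrite !hnu !h0 !z0 subr0 addr0.
Qed.

Lemma cmeasure_val_complex_measure_of A :
  cmeasure_val complex_measure_of A = (fine (nu A))%:C.
Proof. by []. Qed.

End MeasureAsComplexMeasure.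

Section Support.
Variable R : realType.

Lemma measure_support_closed (mu : complex_measure R) : closed (measure_support mu).
Proof.
rewrite -openC openE => t /=; rewrite /interior.
move=> /existsNP[U /not_implyP[[oU Ut] hU]].
apply: filterS (open_nbhs_nbhs (conj oU Ut)) => s Us hs; apply: hU.
by apply: hs; split.
Qed.

Lemma measure_support_out (nu : probability (borel_circle R) R) (t : circle R)
    (U : set (circle R)) :
  open_nbhs t U -> nu (U : set (borel_circle R)) = 0%E ->
  ~ measure_support (complex_measure_of nu) t.
Proof.
move=> tU U0 /(_ U tU)[A [mA AU]]; apply; rewrite cmeasure_val_complex_measure_of.
have mU := open_measurable_circle tU.1.
by rewrite (subset_measure0 mA mU AU U0).
Qed.

(** The angles of the points of [E] lie in a level set of the power sum along
    [cis], which is null. *)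
Lemma arc_length_null (E : set (circle R)) (b : nat -> R[i]) (beta : R[i]) :
  ell1 b -> nontrivial b -> closed E ->
  (forall t, E t -> power_sum b (set_val t) = beta) -> arc_length E = 0%E.
Proof.
move=> lb nb cE Eb; rewrite /arc_length.
set S := [set theta | _].
have SE : S = `[0, 2 * pi[%classic `&` (@circle_cis R @^-1` E).
  apply/seteqP; split=> t /=; rewrite in_itv/= => -[h].
    move=> [s Es st]; split=> //.
    by have -> : circle_cis t = s by apply: val_inj.
  by move=> Et; split=> //; exists (circle_cis t).
have mS : measurable S.
  rewrite SE; apply: measurableI => //; apply: measurable_realfun.closed_measurable.
  by apply: preimage_closed => // t _; exact: circle_cis_continuous.
have mZ : measurable [set t : R | 0 <= t < 2 * pi /\ power_sum b (cis t) = beta].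
  by have := level_set_measurable beta lb.
apply: (@subset_measure0 _ _ _ (@lebesgue_measure R) _ _ mS mZ);
  last exact: null_level_set.
move=> t; rewrite SE /= in_itv/= => -[h /Eb]; by [].
Qed.

End Support.

(** * The support lies in a level set *)

Section TrigonometricIntegrals.
Variable R : realType.
Variables (nu : probability (borel_circle R) R) (y : nat -> R[i]).
Hypothesis nu_y : forall n,
    y n = Rintegral nu setT (fun t => complex.Re (set_val t ^+ n)) +i*
          Rintegral nu setT (fun t => complex.Im (set_val t ^+ n)).
Implicit Types (a : nat -> R[i]) (t : circle R).

Lemma normc_circle t : normc (set_val t) = 1.
Proof. exact: (set_valP t). Qed.

Lemma integrable_circle (f : circle R -> R) (A : set (borel_circle R)) (c : R) :
  measurable A -> continuous f -> (forall t, `|f t| <= c) ->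
  nu.-integrable A (EFin \o f).
Proof.
move=> mA cf fc; apply: (bounded_integrable nu mA _ fc).
exact: continuous_measurable_circle.
Qed.

Lemma Re_trig_continuous a n :
  continuous (fun t => complex.Re (\sum_(k < n) a k * set_val t ^+ k)).
Proof.
move=> t; apply: (@continuous_comp _ _ _
  (fun t : circle R => \sum_(k < n) a k * set_val t ^+ k)
  (fun z : R[i] => complex.Re z)); last exact: Re_continuous.
elim: n => [|n IH].
  rewrite (_ : (fun _ => _) = fun=> 0); first exact: cst_continuous.
  by apply/funext => s; rewrite big_ord0.
rewrite (_ : (fun _ => _) = fun s : circle R =>
   \sum_(k < n) a k * set_val s ^+ k + a n * set_val s ^+ n); last first.
  by apply/funext => s; rewrite big_ord_recr.
exact: (cvgD IH (cvgM (cvg_cst (a n)) (@circle_exp_continuous R n t))).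
Qed.

Lemma normc_trig_le a n t :
  normc (\sum_(k < n) a k * set_val t ^+ k) <= \sum_(k < n) normc (a k).
Proof.
rewrite (le_trans (le_normc_sum _ _ _))// ler_sum// => k _.
by rewrite normcM normcX normc_circle expr1n mulr1.
Qed.

(** Real parts suffice because only the real part of [conjc beta * f] is
    integrated in the sequel. *)
Lemma Rintegral_Re_trig a n :
  Rintegral nu setT (fun t => complex.Re (\sum_(k < n) a k * set_val t ^+ k)) =
  complex.Re (\sum_(k < n) a k * y k).
Proof.
elim: n => [|n IH].
  rewrite big_ord0 -[RHS](mul0r (fine (nu setT))) -Rintegral_cst//.
  by apply: eq_Rintegral => t _; rewrite big_ord0.
rewrite big_ord_recr/= ReD -IH [in RHS]nu_y.
case E : (a n) => [p q] /=.
have i1 : nu.-integrable setT (EFin \o (fun t => complex.Re (set_val t ^+ n))).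
  apply: (@integrable_circle _ _ 1) => //; first exact: Re_circle_exp_continuous.
  by move=> t; rewrite (le_trans (le_Re_normc _))// normcX normc_circle expr1n.
have i2 : nu.-integrable setT (EFin \o (fun t => complex.Im (set_val t ^+ n))).
  apply: (@integrable_circle _ _ 1) => //; first exact: Im_circle_exp_continuous.
  by move=> t; rewrite (le_trans (le_Im_normc _))// normcX normc_circle expr1n.
have i3 : nu.-integrable setT
    (EFin \o (fun t => complex.Re (\sum_(k < n) a k * set_val t ^+ k))).
  apply: (@integrable_circle _ _ (\sum_(k < n) normc (a k))) => //.
    exact: Re_trig_continuous.
  by move=> t; rewrite (le_trans (le_Re_normc _))// normc_trig_le.
rewrite -!RintegralZl// -RintegralB//; last 2 first.
- exact: (integrableZl measurableT p i1).
- exact: (integrableZl measurableT q i2).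
rewrite -RintegralD//; last first.
  exact: (integrableB measurableT (integrableZl measurableT p i1)
    (integrableZl measurableT q i2)).
apply: eq_Rintegral => t _; rewrite big_ord_recr/= ReD E; congr (_ + _).
by case: (set_val t ^+ n).
Qed.

Variables (b : nat -> R[i]) (M : R).
Hypotheses (lb : ell1 b) (y1 : forall n, normc (y n) <= 1).
Local Notation beta := (coupling b y).
Hypothesis betaM : normc beta = M.
Hypothesis fM : forall z, normc z <= 1 -> normc (power_sum b z) <= M.

Lemma conj_betaM : conjc beta * beta = (M ^+ 2)%:C.
Proof. by rewrite mulrC mulJ_normc betaM. Qed.

Lemma M_ge0 : 0 <= M.
Proof. by rewrite -betaM normc_ge0. Qed.

(** Non-negative on the closed disc, zero only where the power sum takes the value
    [beta], and of integral 0 against [nu]. *)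
Definition defect (z : R[i]) : R := M ^+ 2 - complex.Re (conjc beta * power_sum b z).

Lemma defect_ge0 z : normc z <= 1 -> 0 <= defect z.
Proof.
move=> z1; rewrite subr_ge0 (le_trans (ler_norm _))// (le_trans (le_Re_normc _))//.
by rewrite normcM normc_conj betaM expr2 ler_wpM2l ?M_ge0 ?fM.
Qed.

Lemma defect_eq0 z : normc z <= 1 -> defect z = 0 -> power_sum b z = beta.
Proof.
move=> z1 /eqP; rewrite subr_eq0 => /eqP h.
have [M0|M0] := eqVneq M 0.
  have := fM z1; have := betaM; rewrite M0 => /eq0_normc-> f0.
  by apply: eq0_normc; apply/eqP; rewrite eq_le f0 normc_ge0.
have b0 : conjc beta != 0 by rewrite -normc_eq0 normc_conj betaM.
apply: (mulfI b0); rewrite conj_betaM; set v := _ * _ in h *.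
have : complex.Im v ^+ 2 <= 0.
  have : normc v ^+ 2 <= (M ^+ 2) ^+ 2.
    rewrite lerXn2r ?nnegrE ?normc_ge0 ?sqr_ge0//.
    by rewrite /v normcM normc_conj betaM expr2 ler_wpM2l ?M_ge0 ?fM.
  by rewrite sqr_normcE -h gerDl.
move=> im; have {}im : complex.Im v = 0.
  by apply/eqP; rewrite -sqrf_eq0 eq_le im sqr_ge0.
by apply/eqP; rewrite eq_complex/= -h im !eqxx.
Qed.

Lemma Re_le_normcB (z w : R[i]) : complex.Re z - complex.Re w <= normc (z - w).
Proof.
by rewrite -ReN -ReD (le_trans (ler_norm _))// le_Re_normc.
Qed.

(** The integral of the defect is at least [c] times the measure of [U].  It is
    computed on partial sums of the series, up to remainders that tend to 0, and
    the limit is [M ^+ 2 - complex.Re (conjc beta * beta) = 0]. *)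
Lemma defect_null (U : set (circle R)) (c : R) : open U -> 0 < c ->
  (forall t, U t -> c <= defect (set_val t)) -> nu (U : set (borel_circle R)) = 0%E.
Proof.
move=> oU c0 Uc; have mU := open_measurable_circle oU.
have fnuU : nu (U : set (borel_circle R)) \is a fin_num by exact: fin_num_measure.
suff H n : c * fine (nu (U : set (borel_circle R))) <= 2 * M * l1_tail b n.
  rewrite -(fineK fnuU); congr (_%:E); apply/eqP; rewrite eq_le fine_ge0// andbT.
  have : c * fine (nu (U : set (borel_circle R))) <= 0.
    have cv : (fun n => 2 * M * l1_tail b n) @ \oo --> (2 * M * 0 : R).
      by apply: cvgM; [exact: cvg_cst | exact: l1_tail_cvg].
    rewrite mulr0 in cv; apply: (ler_cvg_to (cvg_cst _) cv).
    exact: nearW.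
  by rewrite pmulr_rle0.
pose a k := conjc beta * b k.
(* A trigonometric polynomial that dominates the defect. *)
pose g t := M ^+ 2 + M * l1_tail b n - complex.Re (\sum_(k < n) a k * set_val t ^+ k).
have aE z : \sum_(k < n) a k * z ^+ k = conjc beta * \sum_(k < n) b k * z ^+ k.
  by rewrite mulr_sumr; apply: eq_bigr => k _; rewrite mulrA.
have gd t : defect (set_val t) <= g t.
  rewrite /defect /g lerBlDr -addrA -lerBlDl opprD addNKr.
  have := Re_le_normcB (\sum_(k < n) a k * set_val t ^+ k)
    (conjc beta * power_sum b (set_val t)).
  rewrite aE -mulrBr normcM normc_conj betaM normcB.
  have := power_sum_approx n lb (_ : normc (set_val t) <= 1).
  rewrite normc_circle lexx => /(_ isT) /(ler_wpM2l M_ge0).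
  by set p := M * _; set q := M * normc _; lra.
have g0 t : 0 <= g t by apply: le_trans (gd t); rewrite defect_ge0// normc_circle.
pose B := M ^+ 2 + M * l1_tail b n + \sum_(k < n) normc (a k).
have gB t : `|g t| <= B.
  rewrite ger0_norm// /g /B lerD2l.
  rewrite (le_trans (ler_norm _))// normrN (le_trans (le_Re_normc _))//.
  exact: normc_trig_le.
have cg : continuous g.
  move=> t; exact: (cvgB (cvg_cst (M ^+ 2 + M * l1_tail b n))
    (@Re_trig_continuous a n t)).
have ig (A : set (borel_circle R)) : measurable A -> nu.-integrable A (EFin \o g).
  by move=> mA; exact: (integrable_circle mA cg gB).
have mCU : measurable (~` U : set (borel_circle R)) by exact: measurableC.
apply: (@le_trans _ _ (Rintegral nu setT g)).
  rewrite -(setUv (U : set (borel_circle R))).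
  rewrite (Rintegral_split (c' := B) nu mU mCU)//; last 2 first.
  - exact/disj_setPCl.
  - exact: continuous_measurable_circle.
  rewrite -[leLHS]addr0 lerD//; last by apply: Rintegral_ge0 => t _; exact: g0.
  rewrite -Rintegral_cst//; apply: le_Rintegral => //; last 2 first.
  - exact: ig.
  - by move=> t /Uc/le_trans; apply; exact: gd.
  by apply: (@integrable_circle _ _ `|c|) => //; exact: cst_continuous.
rewrite RintegralB//; last 2 first.
- apply: (@integrable_circle _ _ `|M ^+ 2 + M * l1_tail b n|) => //.
  exact: cst_continuous.
- apply: (@integrable_circle _ _ (\sum_(k < n) normc (a k))) => //.
    exact: Re_trig_continuous.
  by move=> t; rewrite (le_trans (le_Re_normc _))// normc_trig_le.
rewrite Rintegral_cst// [X in _ * fine X](probability_setT nu) mulr1 Rintegral_Re_trig.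
have -> : \sum_(k < n) a k * y k = conjc beta * \sum_(k < n) y k * b k.
  by rewrite mulr_sumr; apply: eq_bigr => k _; rewrite mulrA mulrAC -mulrA.
have := Re_le_normcB (conjc beta * beta) (conjc beta * \sum_(k < n) y k * b k).
rewrite -mulrBr normcM normc_conj betaM {1}conj_betaM/=.
have := ler_wpM2l M_ge0 (coupling_approx n lb y1).
by set p := M * normc _; lra.
Qed.

Hypothesis M_gt0 : 0 < M.

Lemma defect_continuous : continuous (fun s : circle R => defect (set_val s)).
Proof.
move=> s; apply/(@cvgrPdist_lt _ _ _ _ (nbhs_filter s)) => e e0.
have e1 : 0 < e / M by rewrite divr_gt0.
have [d d0 hd] := power_sum_unif_continuous lb e1.
have := proj1 (cvg_normcP (nbhs_filter s) _ _) (@set_val_circle_continuous R s) d d0.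
apply: filterS => w /= hw.
have {}hd := hd (set_val s) (set_val w); rewrite !normc_circle lexx in hd.
have {}hd := hd isT isT hw; rewrite ltr_pdivlMr// mulrC in hd.
apply: le_lt_trans hd; rewrite /defect opprB addrC subrKA.
rewrite -ReN -ReD (le_trans (le_Re_normc _))//.
by rewrite -mulrBr normcM normc_conj normcB betaM.
Qed.

(** Around a point with positive defect there is an open set on which the defect
    is bounded below, and that set is null. *)
Lemma support_level_set t :
  measure_support (complex_measure_of nu) t -> power_sum b (set_val t) = beta.
Proof.
move=> Et; apply: defect_eq0; first by rewrite normc_circle.
apply: contrapT => /eqP ht.
have c0 : 0 < defect (set_val t).
  by rewrite lt_def ht defect_ge0// normc_circle.
set c := defect _ in c0.
pose U : set (circle R) :=
  (fun s : circle R => defect (set_val s)) @^-1` [set x | c / 2 < x].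
have oU : open U.
  by apply: open_comp; [move=> s _; exact: defect_continuous | exact: open_gt].
have tU : open_nbhs t U by split=> //; rewrite /U/= -/c; lra.
apply: (measure_support_out tU _ Et).
by apply: (defect_null (c := c / 2) oU); [rewrite divr_gt0 | move=> s /ltW].
Qed.

(** Were the supremum smaller than [M], the defect would be bounded below on the
    whole circle, which would then be null. *)
Lemma sup_norm_power_sum : sup_norm (power_sum b) = M%:E.
Proof.
apply/eqP; rewrite eq_le; apply/andP; split.
  by apply: ge_ereal_sup => _ [z z1 <-]; rewrite lee_fin fM.
rewrite leNgt; apply/negP => hs.
have : sup_norm (power_sum b) \is a fin_num.
  rewrite fin_numE; apply/andP; split; last by rewrite lt_eqF// (lt_trans hs)// ltry.
  rewrite gt_eqF//; apply: (@lt_le_trans _ _ (normc (power_sum b 0))%:E).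
    exact: ltNyr.
  apply: ereal_sup_ubound; exists 0 => //.
  by change (normc (0 : R[i]) <= 1); rewrite normc0.
move=> /fineK; set s := fine _ => sE; rewrite -sE lte_fin in hs.
have fs t : normc (power_sum b (set_val t)) <= s.
  rewrite -lee_fin sE; apply: ereal_sup_ubound; exists (set_val t) => //.
  by rewrite /closed_disc/= normc_circle.
have c0 : 0 < M * (M - s) by rewrite mulr_gt0// subr_gt0.
have : nu setT = 0%E.
  apply: (defect_null openT c0) => t _; rewrite /defect mulrBr -expr2 lerD2l lerN2.
  rewrite (le_trans (ler_norm _))// (le_trans (le_Re_normc _))//.
  by rewrite normcM normc_conj betaM ler_wpM2l ?M_ge0.
by rewrite probability_setT => -[] /eqP; rewrite oner_eq0.
Qed.

End TrigonometricIntegrals.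

Theorem theorem3p1 (R : realType) (b : nat -> R[i]) :
  ell1 b -> nontrivial b -> modulus_support_functional (@S0 R) b ->
  exists mu : complex_measure R,
    [/\ rajchman mu,
        S0 (fun n : nat => fourier mu (- n%:Z)),
        modulus_support_point (@S0 R) b (fun n : nat => fourier mu (- n%:Z)),
        weak_peak_set (measure_support mu)
      & weak_peak_function (measure_support mu) (power_sum b)].
Proof.
move=> lb nb [_ _ [y [Sy ymax]]].
have y1 := S0_bounded Sy; have [nu nu_y] := representing_measure Sy.
set beta := coupling b y in ymax; pose M := normc beta.
exists (complex_measure_of nu).
have fy : (fun n : nat => fourier (complex_measure_of nu) (- n%:Z)) = y.
  by apply/funext => n; rewrite fourier_complex_measure_of -nu_y.
have fM_open z : normc z < 1 -> normc (power_sum b z) <= M.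
  move=> z1; rewrite -lee_fin ymax power_sumE; apply: ereal_sup_ubound.
  by exists (phi z) => //; exact: S0_phi.
have fM := power_sum_le_closed_disc lb fM_open.
have M0 : 0 < M.
  have [t ft] := nontrivial_neq0 lb nb.
  rewrite (lt_le_trans _ (fM (cis t) _)) ?normc_cis//.
  by rewrite lt_def normc_eq0 ft normc_ge0.
have beta0 : beta <> 0 by move=> b0; move: M0; rewrite /M b0 normc0 ltxx.
set E := measure_support _.
have Ebeta t : E t -> power_sum b (set_val t) = beta.
  exact: (support_level_set nu_y lb y1 erefl fM M0).
have cE : closed E by exact: measure_support_closed.
have wE : weak_peak_function E (power_sum b).
  split; first by exists b.
  by exists beta; split=> //; exact: (sup_norm_power_sum nu_y lb y1 erefl fM M0).
split; rewrite ?fy//.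
- by rewrite /rajchman fy; case: Sy.
- split=> //; first exact: arc_length_null Ebeta.
  by exists (power_sum b).
Qed.
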